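(* Let $I\subseteq\Bbbk[x_i,x_j,x_k]$ be a monomial ideal and let $\mathbf a\preceq\mathbf b$ in $\mathbb N^3$ be such that $K^{\mathbf b}I$ is the hollow triangle (facets $ij$, $ik$, $jk$) and $\dim_\Bbbk\widetilde H_0(K^{\mathbf a}I;\Bbbk)\neq0$. Let $\lambda=(\mathbf a=\mathbf b_n,\dots,\mathbf b_1,\mathbf b)$ be a saturated decreasing lattice path with $\mathbf b-\mathbf b_1=\mathbf e_i$. Let $r$ be the number of degree vectors $\mathbf c$ on $\lambda$ such that $K^{\mathbf c}I$ has facets exactly the edges $ij$ and $ik$; let $s$ be the number of $\mathbf c$ on $\lambda$ such that $K^{\mathbf c}I$ is the single edge $ij$ with its two endpoints (and $k\notin K^{\mathbf c}I$); and let $m$ be the number of $\mathbf c$ on $\lambda$ such that $K^{\mathbf c}I$ has facets the edge $ij$ and the isolated vertex $k$. Put $s_{i,ij}=(-1)^{j,ij}$, $s_{j,ij}=(-1)^{i,ij}$, $s_{k,ij}=(-1)^{j,ij}$. Then: 1. $D^{\mathbf a\mathbf b,\lambda}_{v,jk}=0$ for all vertices $v$ of $K^{\mathbf a}I$. 2. If $K^{\mathbf a}I$ consists of the two vertices $j$ and $k$ (no edge), then $D^{\mathbf a\mathbf b}_{v,ij}=\frac12 s_{v,ij}$ for each vertex $v$ of $K^{\mathbf a}I$. 3. If $K^{\mathbf a}I$ has facets the edge $ij$ and the isolated vertex $k$, or consists of the three isolated vertices $i,j,k$, then $$D^{\mathbf a\mathbf b}_{i,ij}=s_{i,ij}\frac1{3^{r+1}},\qquad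 D^{\mathbf a\mathbf b}_{j,ij}=s_{j,ij}\frac{3^{r+1}+1}{2\cdot3^{r+1}},\qquad D^{\mathbf a\mathbf b}_{k,ij}=s_{k,ij}\frac{3^{r+1}-1}{2\cdot3^{r+1}}.$$ Here $j$ and $k$ can also be swapped, i.e. $D^{\mathbf a\mathbf b}_{i,ik}=(-1)^{k,ik}\frac1{3^{r+1}}$, $D^{\mathbf a\mathbf b}_{k,ik}=(-1)^{i,ik}\frac{3^{r+1}+1}{2\cdot3^{r+1}}$, $D^{\mathbf a\mathbf b}_{j,ik}=(-1)^{k,ik}\frac{3^{r+1}-1}{2\cdot3^{r+1}}$. 4. If $K^{\mathbf a}I$ consists of the two vertices $i$ and $j$ (no edge), then $$D^{\mathbf a\mathbf b,\lambda}_{v,ij}=s_{v,ij}\frac{3^r+1}{3^r2^{m+s+2}}$$ for each vertex $v$ of $K^{\mathbf a}I$, and $$D^{\mathbf a\mathbf b,\lambda}_{i,ik}=(-1)^{i,ik}\frac{3^r-1}{3^r2^{m+s+2}},\qquad D^{\mathbf a\mathbf b,\lambda}_{j,ik}=(-1)^{k,ik}\frac{3^r-1}{3^r2^{m+s+2}}.$$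
   Context: Throughout $\Bbbk$ is a field with $\operatorname{char}(\Bbbk)\neq 2,3$; $\{i,j,k\}$ is the set of the three variable indices in an arbitrary labelling; $\mathbf e_i,\mathbf e_j,\mathbf e_k$ are the standard basis vectors of $\mathbb N^3$; $\preceq$ is the componentwise order. Koszul complex: $K^{\mathbf b}I=\{\tau\subseteq\{i,j,k\}: \mathbf x^{\mathbf b-\tau}\in I\}$, where $\tau$ is identified with its $0/1$ indicator vector (a monomial with a negative exponent is not in $I$). Fix a total order on the vertices to orient faces; $ij$ denotes the oriented edge on $\{i,j\}$ (orientation determined by the order). Sign notation: for a face $F=i_1\cdots i_l$ containing a vertex $u$, $(-1)^{u,F}$ is the sign of the face $F\setminus\{u\}$ in $\partial F$; e.g. $(-1)^{i,ij}$ is the coefficient of the vertex $j$ in $\partial(ij)$ and $(-1)^{j,ij}$ that of $i$. For a simplicial complex $K$, $K_d$ is the set of $d$-faces, $\widetilde C_d$ and $\widetilde B_d$ the reduced chains and boundaries over $\Bbbk$, $\partial$ the reduced boundary map. A shrubbery in dimension $d$ is $T_d\subseteq K_d$ whose boundaries $\partial\tau$, $\tau\in T_d$, form a basis of $\widetilde B_{d-1}(K)$. A stake set in dimension $d$ is $S_d\subseteq K_d$ whose complement $K_d\setminus S_d$ gives a basis of $\widetilde C_d(K)/\widetilde B_d(K)$. A hedge of dimension $d$ is a pair $ST_d=(S_{d-1},T_d)$. The circuit of a $d$-face $\tau$ is the unique cycle $\zeta_{T_d}(\tau)=\tau-t$ with $t\in\Bbbk\{T_d\}$; $\tau$ is cycle-linked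 to $\tau'$ if $\tau'$ has nonzero coefficient in it. The shrub of a stake $\sigma\in S_{d-1}$ is the unique chain $s(\sigma)\in\Bbbk\{T_d\}$ whose boundary has coefficient $1$ on $\sigma$ and $0$ on all other stakes in $S_{d-1}$; $\sigma$ is chain-linked to $\tau'$ if $\tau'$ has nonzero coefficient in $s(\sigma)$. The hedge rim of a $d$-face $\tau$ is the unique chain $r(\tau)\in\Bbbk\{K_d\setminus S_d\}$ with $\tau-r(\tau)$ a boundary; $\tau$ is boundary-linked to $\tau'$ if $\tau'$ has nonzero coefficient in $r(\tau)$. $\Lambda(\mathbf a,\mathbf b)$ is the set of saturated decreasing lattice paths $\lambda=(\mathbf a=\mathbf b_n,\mathbf b_{n-1},\dots,\mathbf b_1,\mathbf b_0=\mathbf b)$, i.e. $\mathbf b_{\ell-1}-\mathbf b_\ell$ is a standard basis vector $\mathbf e_{k_\ell}$ for each $\ell$. A hedgerow in dimension $d$ on $\lambda$ consists of a stake set $S_d^{\mathbf b}$ in $K^{\mathbf b}I$, a hedge of dimension $d$ in $K^{\mathbf b_\ell}I$ for $\ell=1,\dots,n-1$, and a shrubbery $T_{d-1}^{\mathbf a}$ in $K^{\mathbf a}I$. A chain-link fence along $\lambda$ from a $d$-face $\tau$ of $K^{\mathbf b}I$ to a $(d-1)$-face $\sigma$ of $K^{\mathbf a}I$ consists of a hedgerow and faces $\tau_0,\sigma_1,\tau_1,\dots,\sigma_{n-1},\tau_{n-1},\sigma_n$, with $\tau_\ell\in K_d^{\mathbf b_\ell}I$ and $\sigma_\ell\in K_{d-1}^{\mathbf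 b_\ell}I$, such that $\tau$ is boundary-linked to $\tau_0$; $\sigma_\ell=\tau_{\ell-1}\setminus\{k_\ell\}$ (with $k_\ell\in\tau_{\ell-1}$) for $\ell=1,\dots,n$; $\sigma_\ell$ is a stake in $S_{d-1}^{\mathbf b_\ell}$ chain-linked to $\tau_\ell$ for $1\le\ell\le n-1$; and $\sigma_n$ is cycle-linked to $\sigma$. Its weight $w_\phi$ is the product of: the coefficient of $\tau_0$ in the hedge rim of $\tau$; the coefficients of $\tau_\ell$ in the shrub of $\sigma_\ell$; the coefficients of $\sigma_\ell$ in $\partial\tau_{\ell-1}$; and the coefficient of $\sigma$ in the circuit of $\sigma_n$. (In three variables the extra determinant factors in the general weights are all $1$.) For a $d$-face $\tau\in K^{\mathbf b}I$ and a $(d-1)$-face $\sigma\in K^{\mathbf a}I$, the contribution of $\lambda$ and the sylvan matrix entry are $$D^{\mathbf a\mathbf b,\lambda}_{\sigma,\tau}=\frac1{\Delta_{d,\lambda}I}\sum_{\phi}w_\phi,\qquad D^{\mathbf a\mathbf b}_{\sigma,\tau}=\sum_{\lambda\in\Lambda(\mathbf a,\mathbf b)}D^{\mathbf a\mathbf b,\lambda}_{\sigma,\tau},$$ where $\Delta_{d,\lambda}I$ is the number of hedgerows of dimension $d$ on $\lambda$ and $\phi$ runs over the chain-link fences from $\tau$ to $\sigma$ along $\lambda$. Here $d=1$. *)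

(* Defs.v *)
From HB Require Import structures.
From mathcomp Require Import all_boot all_order all_algebra.
From mathcomp Require Import mpoly.
From Stdlib Require ClassicalEpsilon.

Set Implicit Arguments.
Unset Strict Implicit.
Unset Printing Implicit Defensive.

Import GRing.Theory.
Local Open Scope ring_scope.

(* A simplicial complex on V is a {set {set V}}; the empty face (dimension -1)
   counts, so that chains, boundaries and homology are the reduced ones.
   Dimensions are integers. *)
Section Complexes.

Variables (V : finType) (K : {set {set V}}).

Definition faces (d : int) : {set {set V}} :=
  [set t in K | #|t|%:Z == d + 1].

Definition facets : {set {set V}} :=
  [set t in K | [forall u in K, (t \subset u) ==> (u == t)]].

End Complexes.

(* A chain assigns a coefficient to every subset of V. The chains of a complex
   are those supported on its faces. *)
Notation chain V F := {ffun {set V} -> F^o}.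

Section Chains.

Variables (V : finType) (F : fieldType).
(* [le] is the total order of the vertices that orients the faces. *)
Variable le : rel V.

Definition face_chain (t : {set V}) : chain V F := [ffun u => (u == t)%:R].

(* (-1)^{u,t}: removing the vertex in position p of t, counted from 0, has
   sign (-1)^p. *)
Definition face_sign (u : V) (t : {set V}) : F :=
  (-1) ^+ #|[set v in t | (v != u) && le v u]|.

Definition bdry (c : chain V F) : chain V F :=
  \sum_(t : {set V}) c t *: \sum_(u in t) face_sign u t *: face_chain (t :\ u).

Fact bdry_is_linear : linear bdry.
Proof.
move=> a c c'; rewrite /bdry scaler_sumr -big_split /=.
by apply: eq_bigr => t _; rewrite !ffunE scalerDl scalerA.
Qed.
HB.instance Definition _ :=
  GRing.isLinear.Build F (chain V F) (chain V F) _ bdry bdry_is_linear.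

Definition face_span (T : {set {set V}}) : {vspace chain V F} :=
  <<[seq face_chain t | t <- enum T]>>%VS.

Section Complex.

Variable K : {set {set V}}.

Definition chains (d : int) : {vspace chain V F} := face_span (faces K d).

Definition cycles (d : int) : {vspace chain V F} :=
  (chains d :&: lker (linfun bdry))%VS.

Definition boundaries (d : int) : {vspace chain V F} :=
  (linfun bdry @: chains (d + 1))%VS.

Definition betti (d : int) : nat := (\dim (cycles d) - \dim (boundaries d))%N.

Definition shrubbery (d : int) (T : {set {set V}}) : bool :=
  (T \subset faces K d) &&
  basis_of (boundaries (d - 1)) [seq bdry (face_chain t) | t <- enum T].

(* [X] induces a basis of the quotient U / W, for W a subspace of U: it spans U
   modulo W, and no nontrivial combination of [X] lies in W. *)
Definition basis_mod (U W : {vspace chain V F}) (X : seq (chain V F)) : bool :=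
  [&& (<<X>> + W == U)%VS, free X & (<<X>> :&: W == 0)%VS].

Definition stake_set (d : int) (S : {set {set V}}) : bool :=
  (S \subset faces K d) &&
  basis_mod (chains d) (boundaries d)
    [seq face_chain t | t <- enum (faces K d :\: S)].

Definition hedge (d : int) (ST : {set {set V}} * {set {set V}}) : bool :=
  stake_set (d - 1) ST.1 && shrubbery d ST.2.

End Complex.

(* "The unique chain such that P"; it is only meaningful when exactly one such
   chain exists. *)
Definition the_chain (P : chain V F -> Prop) : chain V F :=
  ClassicalEpsilon.epsilon (inhabits 0) P.

Definition circuit (T : {set {set V}}) (t : {set V}) : chain V F :=
  the_chain (fun z => bdry z = 0 /\
    exists2 c, c \in face_span T & z = face_chain t - c).

Definition shrub (S T : {set {set V}}) (s : {set V}) : chain V F :=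
  the_chain (fun c => c \in face_span T /\
    forall s', s' \in S -> bdry c s' = (s' == s)%:R).

Definition hedge_rim (K : {set {set V}}) (d : int) (S : {set {set V}})
    (t : {set V}) : chain V F :=
  the_chain (fun r => r \in face_span (faces K d :\: S) /\
    face_chain t - r \in boundaries K d).

End Chains.

(* The ideal generated by a (possibly infinite) set G of monomials. *)
Definition monomial_ideal (n : nat) (F : fieldType) (I : {pred {mpoly F[n]}}) :=
  exists G : 'X_{1..n} -> Prop, forall p : {mpoly F[n]},
    p \in I <->
    exists s : seq ({mpoly F[n]} * 'X_{1..n}),
      (forall q, q \in s -> G q.2) /\ p = \sum_(q <- s) q.1 * 'X_[q.2].

Definition indicator (n : nat) (t : {set 'I_n}) : 'X_{1..n} :=
  [multinom (v \in t : nat) | v < n].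

(* Subtraction of exponents is truncated: the first condition keeps out the
   monomials with a negative exponent. *)
Definition koszul (n : nat) (F : fieldType) (I : {pred {mpoly F[n]}})
    (b : 'X_{1..n}) : {set {set 'I_n}} :=
  [set t | (indicator t <= b)%MM && ('X_[b - indicator t] \in I)].

(* A saturated decreasing path a = b_n, ..., b_1, b_0 = b is encoded by its
   sequence of steps [:: k_1; ...; k_n], with b_{l-1} - b_l = e_{k_l}. *)
Definition lattice_paths (a b : 'X_{1..3}) :
    {set (mdeg b - mdeg a).-tuple 'I_3} :=
  [set lam : (mdeg b - mdeg a).-tuple 'I_3 |
     b == (a + \sum_(k <- lam) U_(k))%MM].

Definition path_step (lam : seq 'I_3) (l : nat) : 'I_3 := nth ord0 lam l.-1.

Definition path_point (b : 'X_{1..3}) (lam : seq 'I_3) (l : nat) : 'X_{1..3} :=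
  (b - \sum_(k <- take l lam) U_(k))%MM.

Section Sylvan.

Variables (F : fieldType) (le : rel 'I_3) (I : {pred {mpoly F[3]}}).
Variables (d : int) (b : 'X_{1..3}) (lam : seq 'I_3).

Local Notation n := (size lam).
Local Notation K l := (koszul I (path_point b lam l)).

(* (S_d^b, hedges at b_1, ..., b_{n-1}, T_{d-1}^a) *)
Definition hedgerow_type : finType :=
  ({set {set 'I_3}} *
   (n.-1).-tuple ({set {set 'I_3}} * {set {set 'I_3}})%type *
   {set {set 'I_3}})%type.

Definition start_stakes (h : hedgerow_type) := h.1.1.
Definition mid_hedge (h : hedgerow_type) (l : nat) :=
  nth (set0, set0) h.1.2 l.-1.
Definition end_shrubbery (h : hedgerow_type) := h.2.

Definition hedgerow (h : hedgerow_type) : bool :=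
  [&& stake_set F le (K 0) d (start_stakes h),
      all (fun l => hedge F le (K l) d (mid_hedge h l)) (index_iota 1 n)
    & shrubbery F le (K n) (d - 1) (end_shrubbery h)].

Definition num_hedgerows : nat := #|[set h | hedgerow h]|.

(* a hedgerow, (tau_0, ..., tau_{n-1}) and (sigma_1, ..., sigma_n) *)
Definition fence_type : finType :=
  (hedgerow_type * n.-tuple {set 'I_3} * n.-tuple {set 'I_3})%type.

Definition fence_row (phi : fence_type) : hedgerow_type := phi.1.1.
Definition fence_tau (phi : fence_type) (l : nat) := nth set0 phi.1.2 l.
Definition fence_sigma (phi : fence_type) (l : nat) := nth set0 phi.2 l.-1.

Definition rim_coef (phi : fence_type) (tau : {set 'I_3}) : F :=
  hedge_rim F le (K 0) d (start_stakes (fence_row phi)) tau (fence_tau phi 0).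

Definition shrub_coef (phi : fence_type) (l : nat) : F :=
  let ST := mid_hedge (fence_row phi) l in
  shrub F le ST.1 ST.2 (fence_sigma phi l) (fence_tau phi l).

Definition bdry_coef (phi : fence_type) (l : nat) : F :=
  bdry le (face_chain F (fence_tau phi l.-1)) (fence_sigma phi l).

Definition circuit_coef (phi : fence_type) (sigma : {set 'I_3}) : F :=
  circuit F le (end_shrubbery (fence_row phi)) (fence_sigma phi n) sigma.

(* Paths of length n = 0 are never used: [fence_tau] and [fence_sigma] are
   meaningful for 0 <= l < n and 1 <= l <= n respectively. *)
Definition fence (sigma tau : {set 'I_3}) (phi : fence_type) : bool :=
  [&& hedgerow (fence_row phi),
      all (fun l => fence_tau phi l \in faces (K l) d) (index_iota 0 n),
      all (fun l => fence_sigma phi l \in faces (K l) (d - 1))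
        (index_iota 1 n.+1),
      rim_coef phi tau != 0,
      all (fun l => (path_step lam l \in fence_tau phi l.-1) &&
                    (fence_sigma phi l == fence_tau phi l.-1 :\ path_step lam l))
        (index_iota 1 n.+1),
      all (fun l => (fence_sigma phi l \in (mid_hedge (fence_row phi) l).1) &&
                    (shrub_coef phi l != 0))
        (index_iota 1 n)
    & circuit_coef phi sigma != 0].

(* In three variables the determinant factors of the general weights are 1. *)
Definition fence_weight (sigma tau : {set 'I_3}) (phi : fence_type) : F :=
  rim_coef phi tau * (\prod_(1 <= l < n) shrub_coef phi l) *
  (\prod_(1 <= l < n.+1) bdry_coef phi l) * circuit_coef phi sigma.

Definition path_contribution (sigma tau : {set 'I_3}) : F :=
  (num_hedgerows%:R)^-1 *
  \sum_(phi : fence_type | fence sigma tau phi) fence_weight sigma tau phi.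

End Sylvan.

Definition sylvan_entry (F : fieldType) (le : rel 'I_3)
    (I : {pred {mpoly F[3]}}) (d : int) (a b : 'X_{1..3})
    (sigma tau : {set 'I_3}) : F :=
  \sum_(lam in lattice_paths a b) path_contribution le I d b lam sigma tau.

(* The points of a path are pairwise distinct: counting their positions l counts
   the points. *)
Definition count_on_path (F : fieldType) (I : {pred {mpoly F[3]}})
    (b : 'X_{1..3}) (lam : seq 'I_3) (Fc : {set {set 'I_3}}) : nat :=
  #|[set l : 'I_(size lam).+1 | facets (koszul I (path_point b lam l)) == Fc]|.

(* Main.v *)
Require Import Defs.
From mathcomp Require Import all_boot all_order all_algebra.
From mathcomp Require Import mpoly.
From mathcomp Require Import ring.
From Stdlib Require ClassicalEpsilon.

Import GRing.Theory.
Local Open Scope ring_scope.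

Set Implicit Arguments.
Unset Strict Implicit.
Unset Printing Implicit Defensive.

(* For t not containing x, a face t lies in K^(c - e_x) iff x |: t lies in K^c,
   and K^a is contained in K^c for all c on the path. Hence if a vertex v <> x
   survives in K^a, every step along x leaves a degree whose complex contains
   the edge xv. As jk is gone after the first step, the only complexes met before
   the end are the cherry j - i - k, the edge ij, and the edge ij with the
   isolated vertex k.

   The weights of the fences are summed backwards along the path, as a function u
   of the current vertex. At a cherry the hedges are the three choices of a
   vertex that is not a stake, so a step along i replaces (u j, u k) by
   (2 u j - u k, 2 u k - u j): the vector (1, 1) is fixed and (1, -1) is tripled,
   which gives the terms (3^r + 1) / 2 and (3^r - 1) / 2. A complex with the single
   edge ij has two hedges, preserves u j = - u i, and kills u k. Normalisation
   divides by the number of hedgerows, a factor 3 for each cherry, a factor 2 for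
   each single edge, and a factor for the choice of the vertex that is the final
   shrubbery. *)

(** * Chains, stake sets and shrubberies *)

Section FaceSpans.

Variables (V : finType) (F : fieldType).
Implicit Types (T : {set {set V}}) (c : chain V F).

Lemma face_chainE (t u : {set V}) : face_chain F t u = (u == t)%:R.
Proof. exact: ffunE. Qed.

Lemma scale_chainE (x : F) c u : (x *: c) u = x * c u.
Proof. exact: ffunE. Qed.

Lemma face_chain_neq0 (t : {set V}) : face_chain F t != 0.
Proof. by apply/eqP=> /ffunP/(_ t)/eqP; rewrite !ffunE eqxx oner_eq0. Qed.

Lemma nth_face_chains T n : (n < #|T|)%N ->
  [seq face_chain F t | t <- enum T]`_n = face_chain F (nth set0 (enum T) n).
Proof. by move=> nT; rewrite (nth_map set0) // -cardE. Qed.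

(** Face chains are the standard basis of the space of all chains, so membership in a span is a
    condition on the support. Later memberships are checked coefficient by coefficient. *)
Lemma face_spanP T c :
  reflect (forall u, u \notin T -> c u = 0) (c \in face_span F T).
Proof.
apply: (iffP idP) => [cT u uT | c0].
  rewrite (coord_span cT) sum_ffunE big1 // => n _.
  have nT : (n < #|T|)%N by rewrite (leq_trans (ltn_ord n)) // size_map cardE.
  rewrite scale_chainE nth_face_chains // face_chainE.
  case: eqP => [uE | _]; last by rewrite mulr0.
  by move: uT; rewrite uE -mem_enum mem_nth // -cardE.
have -> : c = \sum_(t in T) c t *: face_chain F t.
  apply/ffunP=> u; rewrite sum_ffunE.
  have [uT | uT] := boolP (u \in T).
    rewrite (bigD1 u) //= scale_chainE face_chainE eqxx mulr1 big1 ?addr0 //.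
    move=> t /andP[_ tu].
    by rewrite scale_chainE face_chainE eq_sym (negPf tu) mulr0.
  rewrite c0 // big1 // => t tT; rewrite scale_chainE face_chainE.
  by case: eqP uT => [-> | _ _]; rewrite ?tT // mulr0.
apply: memv_suml => t tT; apply/memvZ/memv_span/map_f.
by rewrite mem_enum.
Qed.

Lemma mem_face_span T t : t \in T -> face_chain F t \in face_span F T.
Proof. by move=> tT; apply: memv_span; rewrite map_f ?mem_enum. Qed.

Lemma free_face_chains T : free [seq face_chain F t | t <- enum T].
Proof.
apply/freeP => f f0 n.
have /ffunP/(_ (nth set0 (enum T) n)) := f0.
rewrite sum_ffunE (bigD1 n) //= [X in _ = X -> _]ffunE big1 => [|m mn].
  by rewrite scale_chainE nth_face_chains // face_chainE eqxx mulr1 addr0.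
rewrite scale_chainE nth_face_chains // face_chainE.
by rewrite nth_uniq ?enum_uniq -?cardE // (inj_eq val_inj) eq_sym (negPf mn) mulr0.
Qed.

Lemma basis_face_span T : basis_of (face_span F T) [seq face_chain F t | t <- enum T].
Proof. by rewrite /basis_of eqxx free_face_chains. Qed.

(** The chain picked by [epsilon] satisfies [P] as soon as some chain does, and uniqueness then
    forces it to be [c]. *)
Lemma the_chain_eq (P : chain V F -> Prop) c :
  P c -> (forall c', P c' -> c' = c) -> the_chain P = c.
Proof.
move=> Pc Puniq; apply: Puniq.
by apply: ClassicalEpsilon.epsilon_spec; exists c.
Qed.

End FaceSpans.

Section Boundaries.

Variables (V : finType) (F : fieldType) (le : rel V).
Implicit Types (S T : {set {set V}}) (c : chain V F).

Lemma bdry_face (t : {set V}) :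
  bdry le (face_chain F t) =
    \sum_(u in t) face_sign F le u t *: face_chain F (t :\ u).
Proof.
rewrite /bdry (bigD1 t) //= face_chainE eqxx scale1r [X in _ + X]big1 ?addr0 // => u ut.
by rewrite face_chainE (negPf ut) scale0r.
Qed.

Lemma face_sign1 (x : V) : face_sign F le x [set x] = 1.
Proof.
rewrite /face_sign; suff -> : [set v in [set x] | (v != x) && le v x] = set0.
  by rewrite cards0.
by apply/setP=> v; rewrite !inE; case: eqP.
Qed.

Lemma bdry_vertex (x : V) :
  bdry le (face_chain F [set x]) = face_chain F set0.
Proof. by rewrite bdry_face big_set1 face_sign1 scale1r setDv. Qed.

Lemma mem_boundaries (K : {set {set V}}) d c :
  reflect (exists2 e, e \in face_span F (faces K (d + 1)) & c = bdry le e)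
          (c \in boundaries F le K d).
Proof.
apply: (iffP memv_imgP) => -[e eK ->]; exists e => //; rewrite lfunE //.
Qed.

(** The chains on the complement of [S] are the kernel of restriction to [S]. They complement the
    boundaries exactly when restriction maps the boundaries isomorphically onto the functions on
    [S]; the last two conditions are surjectivity and injectivity. *)
Lemma stake_setP (K : {set {set V}}) d S :
    (boundaries F le K d <= chains F K d)%VS ->
  reflect [/\ S \subset faces K d,
      forall f : chain V F,
        exists2 w, w \in boundaries F le K d & {in S, w =1 f} &
      forall w, w \in boundaries F le K d -> {in S, forall u, w u = 0} -> w = 0]
    (stake_set F le K d S).
Proof.
move=> BC; rewrite /stake_set /basis_mod.
apply: (iffP andP) => [[SK /and3P[/eqP XB _ /eqP X0]] | [SK surj inj]].
  split=> // [f | w wB w0].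
    (* Extended by zero off [S], [f] is a chain of [K]. Its boundary part agrees with it on [S],
       where the other part vanishes. *)
    have: [ffun u => if u \in S then f u else 0] \in chains F K d.
      apply/face_spanP => u uK; rewrite ffunE; case: ifP => // uS.
      by rewrite (subsetP SK _ uS) in uK.
    rewrite -XB => /memv_addP[x xX [w wB e]]; exists w => // u uS.
    have /ffunP/(_ u) := e; rewrite !ffunE uS => ->.
    by have /face_spanP-> := xX; rewrite ?add0r // inE uS.
  apply/eqP; rewrite -memv0 -X0 memv_cap wB andbT.
  apply/face_spanP => u; rewrite inE negb_and negbK => /orP[/w0-> // | uK].
  by have /face_spanP-> := subvP BC _ wB.
split=> //; rewrite free_face_chains /=; apply/andP; split; last first.
  rewrite -subv0; apply/subvP => w; rewrite memv_cap => /andP[wX wB].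
  rewrite memv0; apply/eqP/inj => // u uS.
  by have /face_spanP-> := wX; rewrite // inE uS.
rewrite eqEsubv subv_add BC andbT; apply/andP; split.
  apply/span_subvP => _ /mapP[t + ->]; rewrite mem_enum inE => /andP[_ tK].
  exact: mem_face_span.
(* Subtracting the boundary that agrees with [c] on [S] leaves a chain supported off [S]. *)
apply/subvP => c cC; have [w wB wc] := surj c; rewrite -(subrK w c).
apply: memv_add => //; apply/face_spanP => u.
rewrite inE negb_and negbK !ffunE => /orP[/wc-> | uK]; first exact: subrr.
have /face_spanP-> // := cC; have /face_spanP-> // := subvP BC _ wB.
exact: subrr.
Qed.

(** For a set of edges this says that they form a forest. *)
Definition acyclic_faces T :=
  forall c, c \in face_span F T -> bdry le c = 0 -> c = 0.

(** With [bdry] injective on the chains of dimension [d], the boundaries of all the faces are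
    already independent, so no proper subset of them spans. *)
Lemma shrubbery_acyclic (K : {set {set V}}) d T :
  acyclic_faces (faces K d) -> shrubbery F le K d T = (T == faces K d).
Proof.
move=> inj; rewrite /shrubbery; apply/andP/eqP => [[TK /andP[/eqP spanT _]] | ->].
  apply/eqP; rewrite eqEsubset TK; apply/subsetP => t tK.
  have: bdry le (face_chain F t) \in boundaries F le K (d - 1).
    by apply/mem_boundaries; exists (face_chain F t); rewrite // subrK mem_face_span.
  rewrite -spanT.
  have -> : [seq bdry le (face_chain F u) | u <- enum T] =
            [seq linfun (bdry le) c | c <- [seq face_chain F u | u <- enum T]].
    by rewrite -map_comp; apply: eq_map => u /=; rewrite lfunE.
  rewrite -limg_span => /memv_imgP[c cT]; rewrite lfunE /= => e.
  have tc : face_chain F t - c = 0.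
    apply: inj; last by rewrite linearB /= e subrr.
    rewrite memvB ?mem_face_span //; apply/face_spanP => u uK.
    by have /face_spanP-> := cT; rewrite // (contra (subsetP TK u)).
  (* A face [t] outside [T] has coefficient 1 in [face_chain F t - c], because [c] is supported on
     [T]. *)
  apply/negPn/negP => tT; have /ffunP/(_ t) := tc.
  rewrite !ffunE eqxx; have /face_spanP-> // := cT.
  by rewrite subr0 => /eqP; rewrite oner_eq0.
split=> //.
have -> : [seq bdry le (face_chain F u) | u <- enum (faces K d)] =
          [seq linfun (bdry le) c | c <- [seq face_chain F u | u <- enum (faces K d)]].
  by rewrite -map_comp; apply: eq_map => u /=; rewrite lfunE.
rewrite /boundaries /chains subrK; apply: limg_basis_of (basis_face_span _ _).
apply/eqP; rewrite -subv0; apply/subvP=> c; rewrite memv_cap => /andP[cK].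
by rewrite memv_ker lfunE memv0 => /eqP /(inj _ cK) ->.
Qed.

End Boundaries.

(** * Graphs with at most two edges *)

Section Graphs.

Variables (V : finType) (F : fieldType) (le : rel V).
Hypotheses (le_anti : antisymmetric le) (le_total : total le).
Variable K : {set {set V}}.
Implicit Types (S T : {set {set V}}) (x y z : V) (c : chain V F).

(** Two candidates differ by a chain whose boundary vanishes on every stake. That boundary is 0 by
    the injectivity part of [stake_setP], and acyclicity then kills the chain itself. *)
Lemma shrub_eq d S T s c :
    (boundaries F le K (d - 1) <= chains F K (d - 1))%VS ->
    acyclic_faces F le (faces K d) -> hedge F le K d (S, T) ->
    c \in face_span F T ->
    (forall s', s' \in S -> bdry le c s' = (s' == s)%:R) ->
  shrub F le S T s = c.
Proof.
move=> BC acy /andP[/= /(stake_setP _ BC)[_ _ inj] TK] cT cS.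
rewrite shrubbery_acyclic // in TK; rewrite (eqP TK) in cT *.
apply: the_chain_eq => // c' [c'T c'S].
apply/subr0_eq/acy; first exact: memvB.
apply: inj => [|s' s'S].
  by apply/mem_boundaries; exists (c' - c); rewrite // subrK memvB.
by rewrite linearB !ffunE c'S // cS // subrr.
Qed.

(** The edge oriented from [y] to [x] whatever the vertex order. The sign makes its boundary [[x] -
    [y]], which keeps [le] out of the later computations. *)
Definition arc x y : chain V F :=
  face_sign F le y [set x; y] *: face_chain F [set x; y].

Lemma face_sign_edge x y : x != y ->
  face_sign F le x [set x; y] = if le y x then -1 else 1.
Proof.
move=> xy; rewrite /face_sign.
suff -> : [set v in [set x; y] | (v != x) && le v x] =
    if le y x then [set y] else set0.
  by case: ifP; rewrite ?cards1 ?cards0.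
apply/setP=> v; rewrite !inE; case: (eqVneq v x) => [-> | vx] /=.
  by case: ifP; rewrite !inE // (negPf xy).
by case: (eqVneq v y) => [-> | vy]; case: ifP; rewrite !inE ?eqxx ?(negPf vy).
Qed.

Lemma face_signC x y : x != y ->
  face_sign F le y [set x; y] = - face_sign F le x [set x; y].
Proof.
move=> xy; rewrite [in LHS]setUC !face_sign_edge // 1?eq_sym //.
have := le_total x y; have := @le_anti x y.
case: (le x y); case: (le y x) => //=; rewrite ?opprK // => /(_ isT) e.
by rewrite e eqxx in xy.
Qed.

Lemma face_sign_sq x y : x != y ->
  face_sign F le x [set x; y] * face_sign F le x [set x; y] = 1.
Proof. by move=> xy; rewrite face_sign_edge //; case: ifP; rewrite ?mulrNN mulr1. Qed.

Lemma setD1_edge x y : x != y -> [set x; y] :\ x = [set y].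
Proof.
move=> xy; apply/setP=> v; rewrite !inE; case: (eqVneq v x) => //= ->.
by rewrite (negPf xy).
Qed.

Lemma setD2_edge x y : x != y -> [set x; y] :\ y = [set x].
Proof. by move=> xy; rewrite setUC setD1_edge // eq_sym. Qed.

Lemma bdry_edge x y : x != y ->
  bdry le (face_chain F [set x; y]) =
    face_sign F le x [set x; y] *: face_chain F [set y] +
    face_sign F le y [set x; y] *: face_chain F [set x].
Proof.
move=> xy; rewrite bdry_face big_setU1 ?inE //= big_set1 setD1_edge //.
by rewrite setD2_edge.
Qed.

Lemma bdry_arc x y : x != y ->
  bdry le (arc x y) = face_chain F [set x] - face_chain F [set y].
Proof.
move=> xy; have yx : y != x by rewrite eq_sym.
rewrite linearZ /= bdry_edge // scalerDr !scalerA addrC.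
rewrite -[face_sign _ _ x _]opprK -face_signC // mulrN [[set x; y]]setUC.
by rewrite face_sign_sq // scaleN1r scale1r.
Qed.

Lemma bdry_arcE x y v : x != y ->
  bdry le (arc x y) [set v] = (v == x)%:R - (v == y)%:R.
Proof.
by move=> xy; rewrite bdry_arc // !ffunE !(inj_eq set1_inj).
Qed.

Lemma arc_face_span T x y : [set x; y] \in T -> arc x y \in face_span F T.
Proof. by move=> xyT; rewrite memvZ ?mem_face_span. Qed.

Lemma edge_chainE x y (p : F) : x != y ->
  p *: face_chain F [set x; y] = (p * face_sign F le y [set x; y]) *: arc x y.
Proof.
move=> xy; have yx : y != x by rewrite eq_sym.
by rewrite /arc scalerA -mulrA [[set x; y]]setUC face_sign_sq ?mulr1.
Qed.

Lemma face_span_arc x y c : x != y ->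
  c \in face_span F [set [set x; y]] -> exists p, c = p *: arc x y.
Proof.
move=> xy /face_spanP c0; exists (c [set x; y] * face_sign F le y [set x; y]).
rewrite -edge_chainE //; apply/ffunP=> t; rewrite scale_chainE face_chainE.
case: eqP => [-> | txy]; first by rewrite mulr1.
by rewrite mulr0 c0 // inE; apply/eqP.
Qed.

Lemma face_span_arc2 x y z c : uniq [:: x; y; z] ->
    c \in face_span F [set [set x; y]; [set x; z]] ->
  exists p q, c = p *: arc y x + q *: arc z x.
Proof.
rewrite /= !inE negb_or => /and3P[/andP[xy xz] yz _] /face_spanP c0.
have eT : [set x; y] != [set x; z].
  by apply/eqP=> /setP/(_ y); rewrite !inE eqxx orbT eq_sym (negPf xy) (negPf yz).
exists (c [set x; y] * face_sign F le x [set x; y]).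
exists (c [set x; z] * face_sign F le x [set x; z]).
have yx : y != x by rewrite eq_sym.
have zx : z != x by rewrite eq_sym.
rewrite ![[set x; _]]setUC -!edge_chainE // in c0 eT *.
apply/ffunP=> t; rewrite ffunE !scale_chainE !face_chainE.
case: eqP => [-> | txy]; first by rewrite (negPf eT) mulr1 mulr0 addr0.
case: eqP => [-> | txz]; first by rewrite mulr1 mulr0 add0r.
by rewrite !mulr0 addr0 c0 // !inE; apply/norP; split; apply/eqP.
Qed.

(* One link of the fences that use the chain [c] as a shrub and then drop the
   vertex [v], where [u] is the total weight of what remains of a fence. *)
Definition push v (u : {set V} -> F) c : F :=
  \sum_(t in faces K 1 | v \in t)
    (c t : F) * bdry le (face_chain F t) (t :\ v) * u (t :\ v).

Lemma pushD v u c c' : push v u (c + c') = push v u c + push v u c'.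
Proof.
by rewrite /push -big_split; apply: eq_bigr => t _; rewrite ffunE !mulrDl.
Qed.

(** Only the edge itself contributes. Its sign in [arc] and its sign in the boundary multiply to 1
    when [y] is dropped and to -1 when [x] is dropped; [u] is taken at the end that remains. *)
Lemma push_arc v u x y : x != y -> [set x; y] \in faces K 1 ->
  push v u (arc x y) = (v == y)%:R * u [set x] - (v == x)%:R * u [set y].
Proof.
move=> xy xyK; have yx : y != x by rewrite eq_sym.
rewrite /push; have [vxy | vxy] := boolP (v \in [set x; y]); last first.
  rewrite big1 => [|t /andP[_ vt]].
    by rewrite !inE in vxy; case/norP: vxy => /negPf-> /negPf->; rewrite !mul0r subrr.
  rewrite scale_chainE face_chainE; case: eqP => [tE|]; last by rewrite mulr0 !mul0r.
  by rewrite -tE vt in vxy.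
rewrite (bigD1 [set x; y]) ?xyK //= big1 => [|t /andP[_ /negPf tE]]; last first.
  by rewrite scale_chainE face_chainE tE mulr0 !mul0r.
rewrite addr0 scale_chainE face_chainE eqxx mulr1 bdry_edge // ffunE.
rewrite !scale_chainE !face_chainE.
move: vxy; rewrite !inE => /orP[] /eqP->.
  rewrite setD1_edge // !(inj_eq set1_inj) !eqxx (negPf xy) (negPf yx).
  rewrite mulr0 mulr1 addr0 mul0r sub0r mul1r face_signC // mulNr.
  by rewrite face_sign_sq // mulN1r.
rewrite setD2_edge //.
rewrite !(inj_eq set1_inj) !eqxx (negPf xy) (negPf yx).
rewrite mulr0 mulr1 add0r mul0r subr0 mul1r.
by rewrite [[set x; y]]setUC face_sign_sq // mul1r.
Qed.

Lemma faces0P t : reflect (exists2 x, t = [set x] & [set x] \in K)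
                          (t \in faces K 0).
Proof.
rewrite inE; apply: (iffP andP) => [[tK /cards1P[x tx]] | [x -> xK]].
  by exists x; rewrite -?tx.
by rewrite cards1.
Qed.

Lemma sum_face_chain (A : {set {set V}}) t :
  t \in A -> \sum_(u in A) face_chain F t u = 1.
Proof.
move=> tA; rewrite (bigD1 t) //= face_chainE eqxx big1 ?addr0 // => u /andP[_].
by rewrite face_chainE => /negPf->.
Qed.

(** The boundaries are the chains of total coefficient 0. Such a chain is determined by its values
    at all vertices but one, and those values are arbitrary; hence exactly one vertex is left out of
    [S]. *)
Lemma stake_set_connected S : faces K 0 != set0 ->
    (forall w, (w \in boundaries F le K 0) =
       (w \in chains F K 0) && (\sum_(t in faces K 0) w t == 0)) ->
  stake_set F le K 0 S = (S \in [set faces K 0 :\ t | t in faces K 0]).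
Proof.
move=> /set0Pn[t0 t0K] BE.
have BC : (boundaries F le K 0 <= chains F K 0)%VS.
  by apply/subvP=> w; rewrite BE => /andP[].
apply/(stake_setP _ BC)/imsetP => [[SK surj inj] | [t tK ->]].
  have [/subsetP SE | /subsetPn[t tK tS]] := boolP (faces K 0 \subset S).
    (* If every vertex were a stake, some boundary would equal a single vertex on all of them and
       have total 1. *)
    have [w] := surj (face_chain F t0); rewrite BE => /andP[_ /eqP w0] wS.
    have := sum_face_chain t0K; rewrite -(eq_bigr _ (fun t tK => wS t (SE t tK))).
    by move/eqP; rewrite w0 eq_sym oner_eq0.
  exists t => //; apply/eqP; rewrite eqEsubset; apply/andP; split.
    apply/subsetP=> u uS; rewrite in_setD1 (subsetP SK) // andbT.
    by apply: contraNneq tS => <-.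
  (* A second vertex [u] off [S] would give the nonzero boundary [u - t], which vanishes on [S]. *)
  apply/subsetP=> u; rewrite in_setD1 => /andP[ut uK]; apply/negPn/negP => uS.
  have: face_chain F u - face_chain F t = 0.
    apply: inj => [|v vS].
      rewrite BE memvB ?mem_face_span //=.
      under eq_bigr do rewrite !ffunE -!(face_chainE F).
      by rewrite sumrB !sum_face_chain // subrr.
    rewrite !ffunE; case: eqP vS => [->|_]; rewrite ?(negPf uS) // => vS.
    by case: eqP vS => [->|_]; rewrite ?(negPf tS) // subrr.
  move/ffunP/(_ u)/eqP; rewrite !ffunE eqxx (negPf ut) subr0.
  by rewrite oner_eq0.
split=> [|f|w]; first exact: subD1set.
  (* The value [- s] at the omitted vertex [t] makes the total 0. *)
  pose s := \sum_(u in faces K 0 :\ t) f u.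
  exists [ffun u => if u == t then - s else if u \in faces K 0 then f u else 0].
    rewrite BE; apply/andP; split.
      apply/face_spanP=> u uK; rewrite ffunE (negPf uK).
      by case: eqP uK => [->|//]; rewrite tK.
    rewrite (bigD1 t) //= ffunE eqxx addrC subr_eq0 /s; apply/eqP.
    apply: eq_big => [u|u]; first by rewrite in_setD1 andbC.
    by move=> /andP[uK /negPf ut]; rewrite ffunE ut uK.
  by move=> u; rewrite in_setD1 ffunE => /andP[/negPf-> ->].
rewrite BE => /andP[/face_spanP wK w0] wS; apply/ffunP=> u; rewrite [RHS]ffunE.
have [uK | /wK //] := boolP (u \in faces K 0).
have [-> | ut] := eqVneq u t; last by apply: wS; rewrite in_setD1 ut.
move: w0; rewrite (bigD1 t) //= big1 ?addr0 => [/eqP//|v /andP[vK vt]].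
by apply: wS; rewrite in_setD1 vt.
Qed.

(** One degree in the sum over fences: a fence arrives at the stake [s], any hedge with this stake
    may be used, and the next step of the path drops [v]. *)
Definition step_sum v (u : {set V} -> F) s : F :=
  \sum_(ST | hedge F le K 1 ST && (s \in ST.1))
    push v u (shrub F le ST.1 ST.2 s).

(** * Cherries: two edges sharing the vertex [x] *)

Section Cherry.

Variables x y z : V.
Hypothesis xyz : uniq [:: x; y; z].
Hypothesis K1 : faces K 1 = [set [set x; y]; [set x; z]].
Hypothesis K0 : faces K 0 = [set [set x]; [set y]; [set z]].

Let yx : y != x.
Proof. by move: xyz; rewrite /= !inE negb_or eq_sym => /and3P[/andP[]]. Qed.
Let zx : z != x.
Proof. by move: xyz; rewrite /= !inE negb_or ![x == _]eq_sym => /and3P[/andP[]]. Qed.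
Let yz : y != z.
Proof. by move: xyz; rewrite /= !inE => /and3P[]. Qed.
Let zy : z != y. Proof. by rewrite eq_sym. Qed.
Let xy : x != y. Proof. by rewrite eq_sym. Qed.
Let xz : x != z. Proof. by rewrite eq_sym. Qed.

Let yxK : [set y; x] \in faces K 1. Proof. by rewrite setUC K1 !inE eqxx. Qed.
Let zxK : [set z; x] \in faces K 1.
Proof. by rewrite setUC K1 !inE eqxx orbT. Qed.

Let bdry_cherry (p q : F) :
  bdry le (p *: arc y x + q *: arc z x) =
    p *: (face_chain F [set y] - face_chain F [set x]) +
    q *: (face_chain F [set z] - face_chain F [set x]).
Proof. by rewrite linearD -!bdry_arc //; congr (_ + _); apply: linearZ. Qed.

Let bdry_cherryE (p q : F) v :
  bdry le (p *: arc y x + q *: arc z x) [set v] =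
    p * ((v == y)%:R - (v == x)%:R) + q * ((v == z)%:R - (v == x)%:R).
Proof. by rewrite bdry_cherry ffunE !scale_chainE !ffunE !(inj_eq set1_inj). Qed.

(** Each leaf lies on one edge only, so the boundary shows the coefficients of the two arcs at the
    leaves. *)
Lemma acyclic_cherry : acyclic_faces F le (faces K 1).
Proof.
move=> c; rewrite K1 => /(face_span_arc2 xyz)[p [q ->]] /ffunP b0.
have := b0 [set y]; have := b0 [set z].
rewrite !bdry_cherryE !ffunE !eqxx.
rewrite (negPf yx) (negPf yz) (negPf zx) (negPf zy) !subr0 !mulr1 !mulr0.
by rewrite addr0 add0r => -> ->; rewrite !scale0r addr0.
Qed.

Lemma sum_faces0_cherry (A : nmodType) (f : {set V} -> A) :
  \sum_(t in faces K 0) f t = f [set x] + f [set y] + f [set z].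
Proof.
rewrite K0 -setUA big_setU1 /=; last by rewrite !inE !(inj_eq set1_inj) negb_or xy.
by rewrite big_setU1 ?big_set1 ?addrA //= inE (inj_eq set1_inj).
Qed.

Lemma boundaries_cherry w :
  (w \in boundaries F le K 0) =
    (w \in chains F K 0) && (\sum_(t in faces K 0) w t == 0).
Proof.
rewrite sum_faces0_cherry; apply/mem_boundaries/andP => [[c] | [/face_spanP wK w0]].
  rewrite add0r K1 => /(face_span_arc2 xyz)[p [q ->]] ->; split.
    rewrite bdry_cherry.
    by apply: memvD; apply: memvZ; apply: memvB;
      rewrite mem_face_span // K0 !inE eqxx ?orbT.
  apply/eqP; rewrite !bdry_cherryE !eqxx.
  rewrite (negPf xy) (negPf yx) (negPf xz) (negPf zx) (negPf yz) (negPf zy) /=.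
  by ring.
(* The leaves dictate both coefficients; the value at the centre then agrees because the total is
   0. *)
exists (w [set y] *: arc y x + w [set z] *: arc z x).
  by rewrite add0r; apply: memvD; apply/memvZ/arc_face_span.
apply/ffunP=> t; have [tK | tK] := boolP (t \in faces K 0); last first.
  rewrite wK // bdry_cherry.
  rewrite K0 !inE !negb_or in tK; case/andP: tK => /andP[tx ty] tz.
  rewrite !ffunE (negPf tx) (negPf ty) (negPf tz) !subrr.
  by rewrite !scaler0 addr0.
move: tK; rewrite K0 !inE => /orP[/orP[]|] /eqP->; rewrite bdry_cherryE !eqxx;
rewrite ?(negPf xy) ?(negPf yx) ?(negPf xz) ?(negPf zx) ?(negPf yz) ?(negPf zy) /=.
- by move/eqP: w0; rewrite -addrA => /eqP; rewrite addr_eq0 => /eqP->; ring.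
- by ring.
- by ring.
Qed.

Let hedge_cherry ST : hedge F le K 1 ST =
  (ST \in [set (faces K 0 :\ t, faces K 1) | t in faces K 0]).
Proof.
have K0n0 : faces K 0 != set0.
  by apply/set0Pn; exists [set x]; rewrite K0 !inE eqxx.
case: ST => S T; rewrite /hedge /= subrr.
rewrite (shrubbery_acyclic _ acyclic_cherry).
rewrite (stake_set_connected _ K0n0 boundaries_cherry).
apply/andP/imsetP => [[/imsetP[t tK ->] /eqP->] | [t tK [-> ->]]].
  by exists t.
by split=> //; apply: imset_f.
Qed.

Lemma sum_hedges_cherry (A : nmodType) (f : {set {set V}} * {set {set V}} -> A) :
  \sum_(ST | hedge F le K 1 ST) f ST =
    f (faces K 0 :\ [set x], faces K 1) + f (faces K 0 :\ [set y], faces K 1) +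
    f (faces K 0 :\ [set z], faces K 1).
Proof.
rewrite (eq_bigl _ _ hedge_cherry) big_imset /= ?sum_faces0_cherry //.
move=> t t' tK t'K [e]; apply/eqP/negPn/negP => tt'.
by move/setP/(_ t): e; rewrite !in_setD1 eqxx tt' tK.
Qed.

Let shrub_cherry v w c : [set v] \in faces K 0 ->
    c \in face_span F (faces K 1) ->
    (forall v', v' != v -> bdry le c [set v'] = (v' == w)%:R) ->
  shrub F le (faces K 0 :\ [set v]) (faces K 1) [set w] = c.
Proof.
move=> vK cK cE; apply: (@shrub_eq 1) cK _; first last.
- move=> s; rewrite in_setD1 => /andP[sv /faces0P[v' sE _]].
  by move: sv; rewrite sE !(inj_eq set1_inj) => /cE.
- by rewrite hedge_cherry; apply: imset_f.
- exact: acyclic_cherry.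
- by rewrite subrr; apply/subvP=> b; rewrite boundaries_cherry => /andP[].
Qed.

(** The three hedges omit [x], [y] or [z] from the stakes. The shrub of [y] is the route joining it
    to the omitted vertex: one arc for [x], both arcs for [z]. Omitting [y] contributes nothing, as
    [y] is then no stake. *)
Lemma step_sum_cherry v u :
  step_sum v u [set y] = push v u (arc y x) *+ 2 + push v u (arc x z).
Proof.
rewrite /step_sum big_mkcondr sum_hedges_cherry /= K0.
rewrite !in_setD1 !inE !(inj_eq set1_inj) !eqxx (negPf yx) (negPf yz) /= -K0.
have xzK : [set x; z] \in faces K 1 by rewrite setUC.
rewrite (@shrub_cherry x y (arc y x)); first last.
- by move=> v' /negPf v'x; rewrite bdry_arcE // v'x subr0.
- exact: arc_face_span.
- by rewrite K0 !inE eqxx.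
rewrite (@shrub_cherry z y (arc y x + arc x z)); first last.
- move=> v' /negPf v'z; rewrite linearD ffunE !bdry_arcE // v'z subr0.
  by rewrite subrK.
- by apply: memvD; apply: arc_face_span.
- by rewrite K0 !inE eqxx orbT.
by rewrite pushD addr0 addrA.
Qed.

End Cherry.

(** * One edge, possibly with isolated vertices *)

Section SingleEdge.

Variables x y : V.
Hypothesis xy : x != y.
Hypothesis K1 : faces K 1 = [set [set x; y]].
Hypotheses (xK : [set x] \in K) (yK : [set y] \in K).

Lemma acyclic_single : acyclic_faces F le (faces K 1).
Proof.
move=> c; rewrite K1 => /(face_span_arc xy)[p ->] /ffunP/(_ [set x]).
rewrite linearZ /= scale_chainE bdry_arcE // eqxx (negPf xy) subr0 mulr1 => ->.
by rewrite ffunE scale0r.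
Qed.

Let memB w : reflect (exists p, w = p *: (face_chain F [set x] - face_chain F [set y]))
  (w \in boundaries F le K 0).
Proof.
apply: (iffP (mem_boundaries _ _ _ _)) => [[c]|[p ->]].
  rewrite add0r K1 => /(face_span_arc xy)[p ->] ->; exists p.
  by rewrite linearZ /= bdry_arc.
exists (p *: arc x y); last by rewrite linearZ /= bdry_arc.
by rewrite memvZ // arc_face_span // add0r K1 inE.
Qed.

Let boundaries_chains : (boundaries F le K 0 <= chains F K 0)%VS.
Proof.
apply/subvP=> _ /memB[p ->]; apply/memvZ/memvB; apply: mem_face_span.
  by apply/faces0P; exists x.
by apply/faces0P; exists y.
Qed.

Let yx : y != x. Proof. by rewrite eq_sym. Qed.

(** The boundaries form the line spanned by [[x] - [y]]. It restricts isomorphically to [S] exactly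
    when [S] is one end of the edge, so an isolated vertex is never a stake. *)
Lemma stake_set_single S :
  stake_set F le K 0 S = (S == [set [set x]]) || (S == [set [set y]]).
Proof.
have B0 (p : F) t : (p *: (face_chain F [set x] - face_chain F [set y])) t =
    p * ((t == [set x])%:R - (t == [set y])%:R) by rewrite scale_chainE !ffunE.
apply/(stake_setP _ boundaries_chains)/orP => [[SK surj inj] | SE].
  have Sxy t : t \in S -> (t == [set x]) || (t == [set y]).
    move=> tS; have [_ /memB[p ->] /(_ t tS)] := surj (face_chain F t).
    rewrite B0 face_chainE eqxx.
    case: eqP => // _; case: eqP => // _.
    by rewrite subr0 mulr0 => /eqP; rewrite eq_sym oner_eq0.
  have [xS | xS] := boolP ([set x] \in S); [left | right].
    rewrite eqEsubset sub1set xS andbT; apply/subsetP=> t tS; rewrite inE.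
    case/orP: (Sxy t tS) => // /eqP tE; rewrite tE in tS.
    (* Were both ends stakes, some boundary would be 1 at [x] and 0 at [y], but its values at the
       ends are opposite. *)
    have [_ /memB[p ->] pS] := surj (face_chain F [set x]).
    have := pS _ tS; have := pS _ xS; rewrite !B0 !face_chainE.
    rewrite !(inj_eq set1_inj) !eqxx (negPf xy) (negPf yx) subr0 sub0r mulr1 => ->.
    by rewrite mul1r => /eqP; rewrite oppr_eq0 oner_eq0.
  have Sy t : t \in S -> t = [set y].
    by move=> tS; case/orP: (Sxy t tS) => /eqP // tx; rewrite tx (negPf xS) in tS.
  rewrite eqEsubset; apply/andP; split; first by apply/subsetP=> t /Sy->; rewrite inE.
  rewrite sub1set; apply/negPn/negP => yS.
  (* At this point [S] is empty, so even the nonzero boundary [[x] - [y]] vanishes on it. *)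
  have: (1 : F) *: (face_chain F [set x] - face_chain F [set y]) = 0.
    apply: inj => [|t tS]; first by apply/memB; exists 1.
    by rewrite -(Sy t tS) tS in yS.
  move/ffunP/(_ [set x]); rewrite B0 [RHS]ffunE !(inj_eq set1_inj) eqxx (negPf xy).
  by move/eqP; rewrite subr0 mulr1 oner_eq0.
have xK0 : [set x] \in faces K 0 by apply/faces0P; exists x.
have yK0 : [set y] \in faces K 0 by apply/faces0P; exists y.
have B0x p : (p *: (face_chain F [set x] - face_chain F [set y])) [set x] = p.
  by rewrite B0 !(inj_eq set1_inj) eqxx (negPf xy) subr0 mulr1.
have B0y p : (p *: (face_chain F [set x] - face_chain F [set y])) [set y] = - p.
  by rewrite B0 !(inj_eq set1_inj) eqxx (negPf yx) sub0r mulrN1.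
split=> [|f|_ /memB[p ->] p0].
- by case: SE => /eqP->; rewrite sub1set.
- case: SE => /eqP->.
    exists (f [set x] *: (face_chain F [set x] - face_chain F [set y])).
      by apply/memB; exists (f [set x]).
    by move=> t /set1P->; rewrite B0x.
  exists (- f [set y] *: (face_chain F [set x] - face_chain F [set y])).
    by apply/memB; exists (- f [set y]).
  by move=> t /set1P->; rewrite B0y opprK.
suff -> : p = 0 by rewrite scale0r.
case: SE => /eqP SE.
  by have := p0 [set x]; rewrite SE B0x; apply; rewrite inE.
have := p0 [set y]; rewrite SE B0y inE eqxx => /(_ isT)/eqP.
by rewrite oppr_eq0 => /eqP.
Qed.

Let hedge_single S T : hedge F le K 1 (S, T) =
  ((S == [set [set x]]) || (S == [set [set y]])) && (T == faces K 1).
Proof.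
by rewrite /hedge /= subrr stake_set_single (shrubbery_acyclic _ acyclic_single).
Qed.

Lemma sum_hedges_single (A : nmodType) (f : {set {set V}} * {set {set V}} -> A) :
  \sum_(ST | hedge F le K 1 ST) f ST =
    f ([set [set x]], faces K 1) + f ([set [set y]], faces K 1).
Proof.
rewrite (eq_bigl (fun ST => ST \in
    [set ([set [set x]], faces K 1); ([set [set y]], faces K 1)])).
  by rewrite big_setU1 ?big_set1 // inE xpair_eqE !(inj_eq set1_inj) (negPf xy).
by case=> S T; rewrite hedge_single !inE !xpair_eqE andb_orl.
Qed.

(** Only one of the two hedges has [x] as a stake, and its shrub is the whole edge. *)
Lemma step_sum_single v u : step_sum v u [set x] = push v u (arc x y).
Proof.
rewrite /step_sum big_mkcondr sum_hedges_single /= !inE eqxx.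
rewrite (inj_eq set1_inj) (negPf xy) addr0.
have arcK : arc x y \in face_span F (faces K 1).
  by apply: arc_face_span; rewrite K1 inE.
congr push; apply: (@shrub_eq 1) acyclic_single _ arcK _.
- by rewrite subrr boundaries_chains.
- by rewrite hedge_single !eqxx.
- by move=> s /set1P->; rewrite bdry_arcE // !eqxx (negPf xy) subr0.
Qed.

Lemma step_sum_single_isolated v u s :
  s != [set x] -> s != [set y] -> step_sum v u s = 0.
Proof.
move=> sx sy; rewrite /step_sum big_mkcondr sum_hedges_single /= !inE.
by rewrite (negPf sx) (negPf sy) addr0.
Qed.

End SingleEdge.

(** * The top dimension, where the space of boundaries is 0 *)

Section TopDimension.

Variable d : int.
Hypothesis Kd1 : faces K (d + 1) = set0.

Let boundaries0 w : (w \in boundaries F le K d) = (w == 0).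
Proof.
apply/mem_boundaries/eqP => [[c] | ->]; last first.
  by exists 0; rewrite ?mem0v // linear0.
rewrite Kd1 => /face_spanP c0 ->.
suff -> : c = 0 by rewrite linear0.
by apply/ffunP=> t; rewrite c0 ?inE // ffunE.
Qed.

Let boundaries_chains0 : (boundaries F le K d <= chains F K d)%VS.
Proof. by apply/subvP=> w; rewrite boundaries0 => /eqP->; apply: mem0v. Qed.

Lemma stake_set_top S : stake_set F le K d S = (S == set0).
Proof.
apply/(stake_setP _ boundaries_chains0)/eqP => [[_ surj _] | ->].
  apply/setP=> t; rewrite inE; apply/negP => tS.
  have [w] := surj (face_chain F t); rewrite boundaries0 => /eqP-> /(_ t tS).
  by move/eqP; rewrite face_chainE eqxx ffunE eq_sym oner_eq0.
split=> [|f|w]; first exact: sub0set; last by rewrite boundaries0 => /eqP.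
by exists 0 => [|t]; rewrite ?mem0v ?inE.
Qed.

(** A chain that differs from [t] by a boundary is [t] itself, so the first face of a fence is
    forced. *)
Lemma hedge_rim_top t : t \in faces K d ->
  hedge_rim F le K d set0 t = face_chain F t.
Proof.
move=> tK; apply: the_chain_eq => [|c [_]].
  by rewrite setD0 mem_face_span // subrr mem0v.
by rewrite boundaries0 subr_eq0 => /eqP.
Qed.

End TopDimension.

(** Every vertex has the empty face as its reduced boundary. The boundaries of dimension -1 thus
    form a line, and a basis of it uses exactly one vertex. *)
Lemma shrubbery_vertex T : (exists x, [set x] \in K) ->
  shrubbery F le K 0 T = (T \in [set [set [set x]] | x in [set x | [set x] \in K]]).
Proof.
case=> x0 x0K.
have bE (A : {set {set V}}) : A \subset faces K 0 ->
    [seq bdry le (face_chain F t) | t <- enum A] = nseq #|A| (face_chain F set0).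
  move=> /subsetP AK; rewrite cardE -(size_map (bdry le \o face_chain F)).
  apply/all_pred1P/allP => _ /mapP[t + ->]; rewrite mem_enum => /AK.
  by case/faces0P=> x -> _; rewrite /= bdry_vertex.
have inB : face_chain F set0 \in boundaries F le K (0 - 1).
  apply/mem_boundaries; exists (face_chain F [set x0]); last by rewrite bdry_vertex.
  by apply: mem_face_span; apply/faces0P; exists x0.
rewrite /shrubbery; apply/andP/imsetP => [[TK] | [x]].
  rewrite (bE _ TK) /basis_of => /andP[/eqP spT /free_uniq].
  have [T0 | T0] := posnP #|T|.
    by move: inB; rewrite -spT T0 span_nil memv0 (negPf (face_chain_neq0 _ _)).
  (* Two vertices would list the same boundary twice, which a free family does not do. *)
  case T1: #|T| T0 => [|[|m]] //= _; last by rewrite inE eqxx.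
  move/eqP/cards1P: T1 => [t Tt] _; rewrite Tt in TK *.
  by move: TK; rewrite sub1set => /faces0P[x -> xK]; exists x; rewrite ?inE.
rewrite inE => xK ->.
have sx : [set [set x]] \subset faces K 0.
  by rewrite sub1set; apply/faces0P; exists x.
split=> //; rewrite (bE _ sx) cards1 /basis_of /= seq1_free face_chain_neq0 andbT.
rewrite span_seq1 eqEsubv -memvE inB /=; apply/subvP=> w /mem_boundaries[c].
rewrite subrK => cK ->; rewrite (coord_span cK) linear_sum /=.
apply: memv_suml => n _; rewrite linearZ /=; apply: memvZ.
rewrite nth_face_chains //.
have: nth set0 (enum (faces K 0)) n \in faces K 0.
  by rewrite -mem_enum mem_nth -?cardE.
by case/faces0P=> y -> _; rewrite bdry_vertex memv_line.
Qed.

Lemma sum_shrubberies_vertex (A : nmodType) (f : {set {set V}} -> A) :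
    (exists x, [set x] \in K) ->
  \sum_(T | shrubbery F le K 0 T) f T =
    \sum_(x | [set x] \in K) f [set [set x]].
Proof.
move=> xK; rewrite (eq_bigl _ _ (fun T => shrubbery_vertex T xK)).
rewrite big_imset /= => [|x y _ _]; last by move/set1_inj/set1_inj.
by apply: eq_bigl => x; rewrite inE.
Qed.

(** Both vertices have the empty face as boundary, and cancelling it forces the coefficient of [x]
    in the subtracted chain to be 1. *)
Lemma circuit_vertex x y :
  circuit F le [set [set x]] [set y] = face_chain F [set y] - face_chain F [set x].
Proof.
apply: the_chain_eq => [|_ [/[swap] [[c /face_spanP cx ->]]]].
  rewrite linearB /= !bdry_vertex subrr; split=> //.
  by exists (face_chain F [set x]); rewrite // mem_face_span // inE.
have -> : c = c [set x] *: face_chain F [set x].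
  apply/ffunP=> t; rewrite scale_chainE face_chainE.
  by case: eqP => [-> | /eqP tx]; rewrite ?mulr1 // cx ?mulr0 // inE.
rewrite linearB linearZ /= !bdry_vertex -{1}[face_chain F set0]scale1r.
move/eqP; rewrite -scalerBl scaler_eq0 (negPf (face_chain_neq0 _ _)) orbF.
rewrite subr_eq0 => /eqP <-.
by rewrite scale1r.
Qed.

End Graphs.

(** * Sums over fences *)

Section TupleSums.

Variables (R : comNzRingType) (A : finType).

Lemma big_tuple0 (f : 0.-tuple A -> R) : \sum_(t : 0.-tuple A) f t = f [tuple].
Proof. by rewrite (big_pred1 [tuple]) // => t; rewrite [t]tuple0 /= eqxx. Qed.

Lemma big_tuple_cons n (f : n.+1.-tuple A -> R) :
  \sum_(t : n.+1.-tuple A) f t = \sum_a \sum_(t : n.-tuple A) f (cons_tuple a t).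
Proof.
rewrite pair_bigA /= (reindex (fun p : A * n.-tuple A => cons_tuple p.1 p.2)) //=.
exists (fun t => (thead t, behead_tuple t)) => [[a t] _ | t _] /=.
  by congr pair; apply/val_inj.
by apply/val_inj; rewrite /= [t in RHS]tuple_eta.
Qed.

(** Distributivity, with factors that depend on the position; it makes the number of hedgerows a
    product. *)
Lemma sum_tuple_prod x0 n (g : nat -> A -> R) :
  \sum_(t : n.-tuple A) \prod_(l < n) g l (nth x0 t l) =
    \prod_(l < n) \sum_a g l a.
Proof.
elim: n g => [|n IH] g; first by rewrite big_tuple0 !big_ord0.
rewrite big_tuple_cons [RHS]big_ord_recl mulr_suml; apply: eq_bigr => a _.
rewrite -(IH (fun l => g l.+1)) mulr_sumr; apply: eq_bigr => t _.
by rewrite big_ord_recl.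
Qed.

Lemma natr_andb (a b : bool) : (a && b)%:R = a%:R * b%:R :> R.
Proof. by case: a; rewrite ?mul1r ?mul0r. Qed.

Lemma natr_all (P : pred nat) m n :
  (all P (iota m n))%:R = \prod_(l < n) (P (m + l)%N)%:R :> R.
Proof.
elim: n m => [|n IH] m; rewrite /= ?big_ord0 // natr_andb IH big_ord_recl addn0.
by congr (_ * _); apply: eq_bigr => l _; rewrite addSnnS.
Qed.

End TupleSums.

Lemma sum_triple (R : nmodType) (A B C : finType) (f : A * B * C -> R) :
  \sum_p f p = \sum_a \sum_b \sum_c f (a, b, c).
Proof. by rewrite !pair_bigA; apply: eq_bigr => -[[]]. Qed.

Section KoszulLinks.

Variables (n : nat) (F : fieldType) (I : {pred {mpoly F[n]}}).
Implicit Types (c : 'X_{1..n}) (t : {set 'I_n}) (x : 'I_n).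

Lemma indicatorD1 x t : x \in t ->
  indicator t = (U_(x) + indicator (t :\ x))%MM.
Proof.
move=> xt; apply/mnmP => y; rewrite mnmDE mnm1E !mnmE in_setD1 eq_sym.
by case: eqVneq => [->|]; rewrite ?xt.
Qed.

(** Removing [x] from the face and lowering the degree by [e_x] leaves the exponent [c - t]
    unchanged. So the faces [sigma_l] of a fence lie in their complexes automatically. *)
Lemma koszul_link d c x t : t \in faces (koszul I c) d -> x \in t ->
  t :\ x \in faces (koszul I (c - U_(x))%MM) (d - 1).
Proof.
rewrite !inE => /andP[/andP[tc tI] td] xt.
rewrite submDA -indicatorD1 // tI andbT; apply/andP; split.
  apply/mnm_lepP => y; have /mnm_lepP/(_ y) := tc.
  rewrite (indicatorD1 xt) mnmDE mnmBE => le_y.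
  by rewrite -(addKn (U_(x)%MM y) (indicator (t :\ x) y)) leq_sub2r.
by move: td; rewrite (cardsD1 x t) xt subrK PoszD addrC => /eqP/addIr->.
Qed.

End KoszulLinks.

(** * Recursive evaluation of the sums over fences *)

Section Fences.

Variables (F : fieldType) (le : rel 'I_3) (I : {pred {mpoly F[3]}}).
Implicit Types (c : 'X_{1..3}) (ks : seq 'I_3) (s t : {set 'I_3}).

(* Total weight of the final parts of fences that start at the vertex [s] of
   K^c and follow the steps [ks], summed over all hedges met on the way. *)
Fixpoint fence_sum c ks sigma s : F :=
  if ks is x :: ks' then
    step_sum le (koszul I c) x (fence_sum (c - U_(x))%MM ks' sigma) s
  else \sum_(T | shrubbery F le (koszul I c) 0 T) (circuit F le T s sigma : F).

(** The denominator that goes with [fence_sum], computed in the field because it is inverted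
    there. *)
Fixpoint hedge_count c ks : F :=
  if ks is x :: ks' then
    (\sum_(ST | hedge F le (koszul I c) 1 ST) 1) * hedge_count (c - U_(x))%MM ks'
  else \sum_(T | shrubbery F le (koszul I c) 0 T) 1.

Lemma path_point_cons c x ks l :
  path_point c (x :: ks) l.+1 = path_point (c - U_(x))%MM ks l.
Proof. by rewrite /path_point /= big_cons submDA. Qed.

Lemma path_point0 c ks : path_point c ks 0 = c.
Proof. by rewrite /path_point take0 big_nil subm0. Qed.

Lemma path_pointS c ks l : (l < size ks)%N ->
  path_point c ks l.+1 = (path_point c ks l - U_(path_step ks l.+1))%MM.
Proof. by move=> lt; rewrite /path_point (take_nth ord0) // big_rcons submDA. Qed.

(** The conditions on one link enter as a 0/1 factor, so that sums over whole tuples can be taken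
    link by link. Here [s] is the stake reached and [s'] the face left after dropping [x]. *)
Definition link_weight K x (ST : {set {set 'I_3}} * {set {set 'I_3}}) t s s' : F :=
  [&& hedge F le K 1 ST, t \in faces K 1, s \in ST.1, x \in t & s' == t :\ x]%:R *
  ((shrub F le ST.1 ST.2 s t : F) * bdry le (face_chain F t) s').

Lemma sum_link_weight K x s (f : {set 'I_3} -> F) :
  \sum_ST \sum_t \sum_s' link_weight K x ST t s s' * f s' = step_sum le K x f s.
Proof.
rewrite /step_sum [RHS]big_mkcond; apply: eq_bigr => ST _.
case: andP => [[hST sST] | nhST]; last first.
  rewrite big1 // => t _; rewrite big1 // => s' _; rewrite /link_weight.
  case: and5P => [[? ? ? _ _]|_]; last by rewrite !mul0r.
  by case: nhST.
rewrite /push [RHS]big_mkcond; apply: eq_bigr => t _.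
rewrite (bigD1 (t :\ x)) //= big1 => [|s' /negPf s'n]; last first.
  by rewrite /link_weight s'n !andbF !mul0r.
rewrite /link_weight hST sST eqxx andbT /= addr0.
by case: ifP; rewrite ?mul1r ?mul0r.
Qed.

(** This unfolds the recursion. Entry [l] of [s :: ss] is the face before link [l], and entry [l] of
    [ss] the face after it. *)
Lemma fence_sum_tuples c ks sigma s :
  fence_sum c ks sigma s =
  \sum_(H : (size ks).-tuple _) \sum_(ts : (size ks).-tuple _)
  \sum_(ss : (size ks).-tuple _)
    (\prod_(l < size ks)
       link_weight (koszul I (path_point c ks l)) (nth ord0 ks l)
         (nth (set0, set0) H l) (nth set0 ts l)
         (nth set0 (s :: ss) l) (nth set0 ss l)) *
    \sum_(T | shrubbery F le (koszul I (path_point c ks (size ks))) 0 T)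
      circuit F le T (nth set0 (s :: ss) (size ks)) sigma.
Proof.
elim: ks c s => [|x ks IH] c s.
  by rewrite !big_tuple0 !path_point0 big_ord0 mul1r.
rewrite /= -sum_link_weight big_tuple_cons; apply: eq_bigr => ST _.
(* The tuples lose their heads one after another; the exchanges bring the three heads in front of
   the three tails. *)
under [RHS]eq_bigr do rewrite big_tuple_cons.
rewrite [RHS]exchange_big; apply: eq_bigr => t _.
under [RHS]eq_bigr do (under eq_bigr do rewrite big_tuple_cons).
rewrite (eq_bigr _ (fun H _ => exchange_big _ _ _ _ _ _)) exchange_big /=.
apply: eq_bigr => s' _; rewrite IH mulr_sumr; apply: eq_bigr => H _.
rewrite mulr_sumr; apply: eq_bigr => ts _.
rewrite mulr_sumr; apply: eq_bigr => ss _.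
rewrite mulrA big_ord_recl path_point0 path_point_cons /=.
by congr (_ * _ * _); apply: eq_bigr => l _; rewrite path_point_cons.
Qed.

Lemma hedgerow_prod b x ks S (H : (size ks).-tuple _) T :
    faces (koszul I b) (1 + 1) = set0 ->
  (hedgerow le I 1 b ((S, H, T) : hedgerow_type (x :: ks)))%:R =
    (S == set0)%:R *
    (\prod_(l < size ks) (hedge F le (koszul I (path_point b (x :: ks) l.+1)) 1
       (nth (set0, set0) H l))%:R *
     (shrubbery F le (koszul I (path_point b (x :: ks) (size ks).+1)) 0 T)%:R) :> F.
Proof.
move=> Kb; rewrite /hedgerow 2!natr_andb natr_all /= subn1 path_point0 subrr.
by rewrite stake_set_top.
Qed.

(** The stake set at [b] is forced to be empty, and the choices at the other degrees are
    independent. *)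
Lemma hedge_countE b x ks : faces (koszul I b) (1 + 1) = set0 ->
  (num_hedgerows le I 1 b (x :: ks))%:R = hedge_count (b - U_(x))%MM ks.
Proof.
move=> Kb.
have hedge_count_prod c : hedge_count c ks =
    \prod_(l < size ks)
      (\sum_(ST | hedge F le (koszul I (path_point c ks l)) 1 ST) 1) *
    \sum_(T | shrubbery F le (koszul I (path_point c ks (size ks))) 0 T) 1.
  elim: ks c => [|y ks' IH] c; first by rewrite /= big_ord0 mul1r path_point0.
  rewrite /= IH path_point_cons big_ord_recl path_point0 -mulrA.
  by under [X in _ = _ * (X * _)]eq_bigr do rewrite path_point_cons.
have toR (A : finType) (P : pred A) : \sum_(u | P u) 1 = \sum_u (P u)%:R :> F.
  by rewrite big_mkcond; apply: eq_bigr => u _; case: (P u).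
have hedgerowE S H T : (hedgerow le I 1 b ((S, H, T) : hedgerow_type (x :: ks)))%:R =
    (S == set0)%:R *
    ((\prod_(l < size ks) (hedge F le (koszul I (path_point (b - U_(x))%MM ks l)) 1
       (nth (set0, set0) H l))%:R) *
    (shrubbery F le (koszul I (path_point (b - U_(x))%MM ks (size ks))) 0 T)%:R) :> F.
  rewrite (hedgerow_prod _ _ _ _ Kb) path_point_cons.
  by under eq_bigr do rewrite path_point_cons.
rewrite hedge_count_prod /num_hedgerows -sum1_card natr_sum.
under [in RHS]eq_bigr do rewrite toR.
rewrite !toR sum_triple (bigD1 set0) //= [X in _ + X]big1 ?addr0; last first.
  move=> S /negPf S0; rewrite big1 // => H _; rewrite big1 // => T _.
  by rewrite inE hedgerowE S0 mul0r.
rewrite -(sum_tuple_prod (set0, set0) _ (fun l ST =>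
  (hedge F le (koszul I (path_point (b - U_(x))%MM ks l)) 1 ST)%:R)).
rewrite mulr_suml; apply: eq_bigr => H _; rewrite mulr_sumr.
by apply: eq_bigr => T _; rewrite inE hedgerowE eqxx mul1r.
Qed.

(** The rim of [tau] is [tau], so every fence starts with [tau_0 = tau] and has to drop the first
    step [x] from it. The rest is summed by [fence_sum]. *)
Lemma path_contributionE b x ks sigma tau :
    faces (koszul I b) (1 + 1) = set0 -> tau \in faces (koszul I b) 1 ->
  path_contribution le I 1 b (x :: ks) sigma tau =
    (hedge_count (b - U_(x))%MM ks)^-1 *
    ((x \in tau)%:R * (bdry le (face_chain F tau) (tau :\ x) *
      fence_sum (b - U_(x))%MM ks sigma (tau :\ x))).
Proof.
move=> Kb tauK; rewrite /path_contribution hedge_countE //; congr (_ * _).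
pose n := size ks; pose c := (b - U_(x))%MM.
(* Weight 0 off the fences lets the sum run over all hedgerows and all tuples of faces. *)
pose W (h : hedgerow_type (x :: ks)) (ts ss : n.+1.-tuple {set 'I_3}) : F :=
  let phi := (h, ts, ss) : fence_type (x :: ks) in
  if fence le I 1 b sigma tau phi then fence_weight le I 1 b sigma tau phi else 0.
have -> : \sum_(phi : fence_type (x :: ks) | fence le I 1 b sigma tau phi)
    fence_weight le I 1 b sigma tau phi = \sum_h \sum_ts \sum_ss W h ts ss.
  rewrite -(sum_triple (fun phi => W phi.1.1 phi.1.2 phi.2)) big_mkcond.
  by apply: eq_bigr => -[[h ts] ss] _.
pose link (H : n.-tuple ({set {set 'I_3}} * {set {set 'I_3}})) ts s ss :=
  \prod_(l < n)
     link_weight (koszul I (path_point c ks l)) (nth ord0 ks l)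
       (nth (set0, set0) H l) (nth set0 ts l)
       (nth set0 (s :: ss) l) (nth set0 ss l).
have WE S H T t ts s ss : W (S, H, T) (cons_tuple t ts) (cons_tuple s ss) =
    [&& S == set0, t == tau, x \in tau & s == tau :\ x]%:R *
    bdry le (face_chain F t) s * link H ts s ss *
    ((shrubbery F le (koszul I (path_point c ks n)) 0 T)%:R *
      circuit F le T (nth set0 (s :: ss) n) sigma).
  pose phi := ((S, H, T) : hedgerow_type (x :: ks),
    cons_tuple t ts, cons_tuple s ss) : fence_type (x :: ks).
  rewrite /W -/phi.
  (* These are the conditions that have to be kept. A nonzero weight already makes all linking
     coefficients nonzero, and [koszul_link] places the faces [sigma_l]. *)
  pose core := [&& hedgerow le I 1 b (fence_row phi),
      all (fun l => fence_tau phi l \in faces (koszul I (path_point b (x :: ks) l)) 1)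
        (index_iota 0 n.+1),
      all (fun l => (path_step (x :: ks) l \in fence_tau phi l.-1) &&
        (fence_sigma phi l == fence_tau phi l.-1 :\ path_step (x :: ks) l))
        (index_iota 1 n.+2) &
      all (fun l => fence_sigma phi l \in (mid_hedge (fence_row phi) l).1)
        (index_iota 1 n.+1)].
  have -> : (if fence le I 1 b sigma tau phi
      then fence_weight le I 1 b sigma tau phi else 0) =
      core%:R * fence_weight le I 1 b sigma tau phi.
    case: ifP => [/and5P[hr ft fs rim /and3P[st sh ci]] | /negbT nf].
      suff -> : core by rewrite mul1r.
      rewrite /core hr ft st /=; apply: sub_all sh => l.
      by case/andP.
    apply/esym/eqP; apply: contraNT nf.
    rewrite mulf_eq0 negb_or => /andP[]; case: (boolP core); rewrite ?eqxx //.
    case/and4P=> hr ft st sk _; rewrite !mulf_eq0 !negb_or.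
    case/andP=> [/andP[/andP[rim sh] _] ci]; apply/and5P; split=> //; last first.
      apply/and3P; split=> //; rewrite prodf_seq_neq0 in sh; apply/allP=> l ln.
      by have := allP sh l ln; rewrite (allP sk) ?implyTb //= => ->.
    apply/allP=> l ln; have /andP[xl /eqP->] := allP st l ln.
    move: ln xl; rewrite mem_index_iota; case: l => // l /= ln xl.
    rewrite path_pointS //; apply: koszul_link => //; apply: (allP ft).
    by rewrite mem_index_iota.
  have facesE : (all (fun l => fence_tau phi l \in
      faces (koszul I (path_point b (x :: ks) l)) 1) (index_iota 0 n.+1))%:R =
    (t \in faces (koszul I b) 1)%:R * \prod_(l < n) (nth set0 ts l \in
      faces (koszul I (path_point b (x :: ks) l.+1)) 1)%:R :> F.
    by rewrite [all _ _]/= natr_andb natr_all path_point0.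
  have stepE : (all (fun l => (path_step (x :: ks) l \in fence_tau phi l.-1) &&
        (fence_sigma phi l == fence_tau phi l.-1 :\ path_step (x :: ks) l))
        (index_iota 1 n.+2))%:R =
    ((x \in t) && (s == t :\ x))%:R *
    \prod_(l < n) ((nth ord0 ks l \in nth set0 ts l) &&
         (nth set0 ss l == nth set0 ts l :\ nth ord0 ks l))%:R :> F.
    by rewrite [all _ _]/= natr_andb natr_all.
  have stakeE : (all (fun l => fence_sigma phi l \in (mid_hedge (fence_row phi) l).1)
        (index_iota 1 n.+1))%:R =
    \prod_(l < n) (nth set0 (s :: ss) l \in (nth (set0, set0) H l).1)%:R :> F.
    by rewrite natr_all subn1.
  have shrubE : \prod_(1 <= l < n.+1) shrub_coef F le phi l =
      \prod_(l < n) shrub F le (nth (set0, set0) H l).1 (nth (set0, set0) H l).2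
        (nth set0 (s :: ss) l) (nth set0 ts l).
    by rewrite big_add1 big_mkord.
  have bdryE : \prod_(1 <= l < n.+2) bdry_coef F le phi l =
      bdry le (face_chain F t) s *
      \prod_(l < n) bdry le (face_chain F (nth set0 ts l)) (nth set0 ss l).
    by rewrite big_add1 big_mkord big_ord_recl.
  have linkE : link H ts s ss =
      \prod_(l < n) (hedge F le (koszul I (path_point b (x :: ks) l.+1)) 1
        (nth (set0, set0) H l))%:R *
      (\prod_(l < n) (nth set0 ts l \in
        faces (koszul I (path_point b (x :: ks) l.+1)) 1)%:R *
      (\prod_(l < n) (nth set0 (s :: ss) l \in (nth (set0, set0) H l).1)%:R *
      (\prod_(l < n) ((nth ord0 ks l \in nth set0 ts l) &&
         (nth set0 ss l == nth set0 ts l :\ nth ord0 ks l))%:R *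
      (\prod_(l < n) shrub F le (nth (set0, set0) H l).1 (nth (set0, set0) H l).2
        (nth set0 (s :: ss) l) (nth set0 ts l) *
      \prod_(l < n) bdry le (face_chain F (nth set0 ts l)) (nth set0 ss l))))).
    rewrite -!big_split; apply: eq_bigr => l _.
    by rewrite /link_weight /= path_point_cons 3!natr_andb !mulrA.
  have rimE : S = set0 -> rim_coef le I 1 b phi tau = (t == tau)%:R.
    move=> S0; rewrite /rim_coef path_point0 -[start_stakes _]/S S0.
    by rewrite hedge_rim_top // face_chainE.
  have [S0 | S0] := eqVneq S set0; last first.
    by rewrite /core 1!natr_andb hedgerow_prod // (negPf S0) !mul0r.
  rewrite /core 3!natr_andb facesE stepE stakeE hedgerow_prod // /fence_weight.
  rewrite rimE //.
  have [tE | tn] := eqVneq t tau; last by rewrite andbF !(mul0r, mulr0).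
  rewrite S0 eqxx [size (x :: ks)]/= -/n shrubE bdryE linkE tE tauK /=.
  rewrite path_point_cons.
  rewrite -[circuit_coef _ _ _ _]/(circuit F le T (nth set0 (s :: ss) n) sigma).
  ring.
(* Only tuples headed by [tau] and by [tau :\ x] contribute. *)
have sumW H T : \sum_ts \sum_ss W (set0, H, T) ts ss =
    (x \in tau)%:R * (bdry le (face_chain F tau) (tau :\ x) *
    \sum_(ts : n.-tuple _) \sum_(ss : n.-tuple _) link H ts (tau :\ x) ss *
      ((shrubbery F le (koszul I (path_point c ks n)) 0 T)%:R *
        circuit F le T (nth set0 (tau :\ x :: ss) n) sigma)).
  rewrite big_tuple_cons (bigD1 tau) //= [X in _ + X]big1 ?addr0; last first.
    move=> t /negPf tn; rewrite big1 // => ts _; rewrite big_tuple_cons.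
    rewrite big1 // => s _; rewrite big1 // => ss _.
    by rewrite WE tn !andbF !mul0r.
  rewrite !mulr_sumr; apply: eq_bigr => ts _.
  rewrite big_tuple_cons (bigD1 (tau :\ x)) //= [X in _ + X]big1 ?addr0; last first.
    move=> s /negPf sn; rewrite big1 // => ss _.
    by rewrite WE sn !andbF !mul0r.
  rewrite !mulr_sumr; apply: eq_bigr => ss _.
  by rewrite WE !eqxx andbT !mulrA.
rewrite sum_triple (bigD1 set0) //= [X in _ + X]big1 ?addr0; last first.
  move=> S /negPf S0; rewrite big1 // => H _; rewrite big1 // => T _.
  rewrite big1 // => ts _; rewrite big1 // => ss _.
  by case/tupleP: ts => t ts; case/tupleP: ss => s ss; rewrite WE S0 !mul0r.
rewrite fence_sum_tuples !mulr_sumr; apply: eq_bigr => H _.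
under eq_bigr do rewrite sumW.
rewrite -!mulr_sumr exchange_big /=; congr (_ * (_ * _)).
apply: eq_bigr => ts _; rewrite exchange_big; apply: eq_bigr => ss _.
rewrite -mulr_sumr; congr (_ * _); rewrite [RHS]big_mkcond.
by apply: eq_bigr => T _; case: ifP; rewrite ?mul1r ?mul0r.
Qed.

End Fences.

(** * Koszul complexes along a path *)

Section MonomialIdeals.

Variables (n : nat) (F : fieldType) (I : {pred {mpoly F[n]}}).
Hypothesis I_monomial : monomial_ideal I.
Implicit Types (m c : 'X_{1..n}) (t u : {set 'I_n}) (x : 'I_n).

Lemma monomial_ideal_up m m' : (m <= m')%MM -> 'X_[m] \in I -> 'X_[m'] \in I.
Proof.
case: I_monomial => G IE le_m /IE[s [sG mE]]; apply/IE.
exists [seq ('X_[m' - m] * q.1, q.2) | q <- s]; split.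
  by move=> _ /mapP[q qs ->]; exact: (sG q).
rewrite -{1}(submK le_m) mpolyXD mE mulr_sumr big_map.
by apply: eq_bigr => q _; rewrite mulrA.
Qed.

Lemma koszul_sub c t u : t \in koszul I c -> u \subset t -> u \in koszul I c.
Proof.
rewrite !inE => /andP[/mnm_lepP tc tI] /subsetP ut.
have le_ut y : (indicator u y <= indicator t y)%N.
  by rewrite !mnmE; case: (boolP (y \in u)) => // /ut->.
apply/andP; split; first by apply/mnm_lepP=> y; apply: leq_trans (tc y).
apply: monomial_ideal_up tI; apply/mnm_lepP=> y.
by rewrite !mnmBE leq_sub2l.
Qed.

Lemma koszul_le c c' t : (c <= c')%MM -> t \in koszul I c -> t \in koszul I c'.
Proof.
rewrite !inE => le_c /andP[tc tI]; rewrite (lepm_trans tc le_c) /=.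
apply: monomial_ideal_up tI; apply/mnm_lepP=> y.
by rewrite !mnmBE leq_sub2r //; apply/mnm_lepP.
Qed.

(** The exponents agree again: lowering [c] by [e_x] and then by [t] is lowering it by [x |: t]. *)
Lemma koszul_cone c x t : (U_(x) <= c)%MM -> x \notin t ->
  t \in koszul I (c - U_(x))%MM -> x |: t \in koszul I c.
Proof.
move=> xc xt; rewrite !inE submDA => /andP[tc tI].
rewrite (@indicatorD1 _ x) ?setU11 // setU1K // tI andbT.
apply/mnm_lepP => y; have /mnm_lepP/(_ y) := tc; have /mnm_lepP/(_ y) := xc.
by rewrite mnmDE mnmBE => xy ty; rewrite -leq_subRL.
Qed.

End MonomialIdeals.

(** * Complexes described by their facets *)

Section FacetsOfClosures.

Variable V : finType.
Implicit Types (K G : {set {set V}}) (t u : {set V}).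

Lemma facets_sub K t : t \in facets K -> t \in K.
Proof. by rewrite inE => /andP[]. Qed.

Lemma facets_max K t u : t \in facets K -> u \in K -> t \subset u -> u = t.
Proof. by rewrite inE => /andP[_ /forall_inP tmax] /tmax /implyP tu /tu/eqP. Qed.

Lemma sub_facet K t : t \in K -> exists2 u, u \in facets K & t \subset u.
Proof.
move=> tK; have [u /maxsetP[uK umax] tu] := @maxset_exists _ (mem K) t tK.
exists u => //; rewrite inE; apply/andP; split=> //.
by apply/forall_inP => v vK; apply/implyP=> uv; apply/eqP/umax.
Qed.

Lemma facetsE K G :
    (forall t, (t \in K) = [exists u in G, t \subset u]) ->
    (forall t u, t \in G -> u \in G -> t \subset u -> t = u) ->
  facets K = G.
Proof.
move=> KE Ganti; apply/setP=> t; rewrite inE.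
have GK u : u \in G -> u \in K.
  by move=> uG; rewrite KE; apply/existsP; exists u; rewrite uG /=.
apply/andP/idP => [[tK /forall_inP tmax] | tG].
  move: (tK); rewrite KE => /exists_inP[u uG tu].
  by have := implyP (tmax u (GK u uG)) tu => /eqP <-.
split; first exact: GK.
apply/forall_inP=> u; rewrite KE => /exists_inP[v vG uv]; apply/implyP=> tu.
have tv := Ganti _ _ tG vG (subset_trans tu uv).
by rewrite eqEsubset tu tv uv.
Qed.

End FacetsOfClosures.

Lemma uniq3P (T : eqType) (x y z : T) :
  uniq [:: x; y; z] -> [/\ x != y, x != z & y != z].
Proof. by rewrite /= !inE negb_or andbT => /andP[/andP[]]. Qed.

Lemma mem_uniq3 (x y z v : 'I_3) : uniq [:: x; y; z] -> v \in [:: x; y; z].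
Proof.
move=> xyz; suff -> : [:: x; y; z] =i 'I_3 by [].
by apply/subset_cardP; [rewrite (card_uniqP xyz) card_ord | apply/subsetP].
Qed.

(** * Complexes on three vertices that contain [ij] but not [jk] *)

Section ThreeVertices.

Variables i j k : 'I_3.
Hypothesis ijk : uniq [:: i; j; k].

Let ij : (i == j) = false.
Proof. by move: ijk; rewrite /= !inE; case: eqVneq. Qed.
Let ik : (i == k) = false.
Proof. by move: ijk; rewrite /= !inE orbC; case: eqVneq. Qed.
Let jk : (j == k) = false.
Proof. by move: ijk; rewrite /= !inE andbT => /andP[_ /negPf]. Qed.
Let ji : (j == i) = false. Proof. by rewrite eq_sym. Qed.
Let ki : (k == i) = false. Proof. by rewrite eq_sym. Qed.
Let kj : (k == j) = false. Proof. by rewrite eq_sym. Qed.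
Let set1_eq (x y : 'I_3) : ([set x] == [set y]) = (x == y).
Proof. exact: (inj_eq set1_inj). Qed.
Let eqs := (ij, ik, jk, ji, ki, kj, @eqxx, set1_eq).

Lemma vertexP x : [\/ x = i, x = j | x = k].
Proof.
by have := mem_uniq3 x ijk; rewrite !inE => /or3P[] /eqP; constructor.
Qed.

Lemma edgeP (t : {set 'I_3}) : #|t| = 2%N ->
  [\/ t = [set i; j], t = [set i; k] | t = [set j; k]].
Proof.
move/eqP/cards2P=> [x [y [xy ->]]].
case: (vertexP x) xy => ->; case: (vertexP y) => ->; rewrite ?eqxx // => _;
by [constructor 1; rewrite ?[[set j; _]]setUC
   | constructor 2; rewrite ?[[set k; _]]setUC
   | constructor 3; rewrite ?[[set k; _]]setUC].
Qed.

Variable K : {set {set 'I_3}}.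
Hypothesis K_closed : forall t u : {set 'I_3}, t \in K -> u \subset t -> u \in K.
Hypothesis jkK : [set j; k] \notin K.
Hypothesis ijK : [set i; j] \in K.

Let sub_edge x y z : [set x; y] \in K -> z \in [set x; y] -> [set z] \in K.
Proof. by move=> xyK zxy; apply: K_closed xyK _; rewrite sub1set. Qed.

Lemma faces1_cherry : [set i; k] \in K ->
  faces K 1 = [set [set i; j]; [set i; k]].
Proof.
move=> ikK; apply/setP=> t; rewrite !inE.
apply/andP/orP => [[tK /eqP[/edgeP[]tE]] | [] /eqP->];
  rewrite ?ijK ?ikK ?cards2 ?eqs //.
- by left; apply/eqP.
- by right; apply/eqP.
by case/negP: jkK; rewrite -tE.
Qed.

Lemma faces0_cherry : [set i; k] \in K ->
  faces K 0 = [set [set i]; [set j]; [set k]].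
Proof.
move=> ikK; apply/setP=> t; apply/faces0P/idP => [[x -> _] | ].
  by case: (vertexP x) => ->; rewrite !inE !eqs ?orbT.
have iK : [set i] \in K by apply: sub_edge ijK _; rewrite !inE eqxx.
have jK : [set j] \in K by apply: sub_edge ijK _; rewrite !inE eqxx orbT.
have kK : [set k] \in K by apply: sub_edge ikK _; rewrite !inE eqxx orbT.
by rewrite !inE => /orP[/orP[]|] /eqP->; [exists i | exists j | exists k].
Qed.

Lemma faces1_single : [set i; k] \notin K -> faces K 1 = [set [set i; j]].
Proof.
move=> ikK; apply/setP=> t; rewrite !inE.
apply/andP/eqP => [[tK /eqP[/edgeP[]tE]] | ->]; rewrite ?ijK ?cards2 ?eqs //.
  by rewrite -tE tK in ikK.
by case/negP: jkK; rewrite -tE.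
Qed.

Let subset_edge (t : {set 'I_3}) x y z : uniq [:: x; y; z] ->
  z \notin t -> t \subset [set x; y].
Proof.
move=> xyz zt; apply/subsetP=> v vt; rewrite !inE.
have := mem_uniq3 v xyz; rewrite !inE orbA => /orP[// | /eqP vz].
by rewrite -vz vt in zt.
Qed.

Lemma facets_cherry : [set i; k] \in K ->
  facets K = [set [set i; j]; [set i; k]].
Proof.
move=> ikK; apply: facetsE => [t|t u].
  apply/idP/exists_inP => [tK | [u]]; last first.
    by rewrite !inE => /orP[] /eqP->; apply: K_closed.
  have [kt | kt] := boolP (k \in t); last first.
    by exists [set i; j]; [rewrite !inE eqxx | apply: subset_edge ijk kt].
  (* A face through [k] misses [j], since [jk] is not a face. *)
  exists [set i; k]; rewrite ?inE ?eqxx ?orbT //.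
  apply: (@subset_edge _ _ _ j); first by rewrite /= !inE !eqs.
  apply: contra jkK => jt; apply: K_closed tK _.
  by apply/subsetP=> v; rewrite !inE => /orP[] /eqP->.
rewrite !inE => /orP[] /eqP-> /orP[] /eqP-> // /subsetP s; exfalso.
  by have := s j; rewrite !inE !eqs => /(_ isT).
by have := s k; rewrite !inE !eqs => /(_ isT).
Qed.

Lemma facets_edge : [set k] \notin K -> facets K = [set [set i; j]].
Proof.
move=> kK; apply: facetsE => [t|t u]; last by rewrite !inE => /eqP-> /eqP->.
apply/idP/exists_inP => [tK | [u]]; last first.
  by rewrite !inE => /eqP->; apply: K_closed.
exists [set i; j]; rewrite ?inE //; apply: subset_edge ijk _.
by apply: contra kK => kt; apply: K_closed tK _; rewrite sub1set.
Qed.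

Lemma facets_edge_vertex : [set i; k] \notin K -> [set k] \in K ->
  facets K = [set [set i; j]; [set k]].
Proof.
move=> ikK kK; apply: facetsE => [t|t u].
  apply/idP/exists_inP => [tK | [u]]; last first.
    by rewrite !inE => /orP[] /eqP->; apply: K_closed.
  have [kt | kt] := boolP (k \in t); last first.
    by exists [set i; j]; [rewrite !inE eqxx | apply: subset_edge ijk kt].
  exists [set k]; rewrite ?inE ?eqxx ?orbT //.
  (* A face through [k] and another vertex would contain [ik] or [jk]. *)
  apply/subsetP=> v vt; rewrite inE; case: (vertexP v) => vE.
  - case/negP: ikK; apply: K_closed tK _.
    by apply/subsetP=> w; rewrite !inE => /orP[] /eqP->; rewrite // -vE.
  - case/negP: jkK; apply: K_closed tK _.
    by apply/subsetP=> w; rewrite !inE => /orP[] /eqP->; rewrite // -vE.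
  by rewrite vE.
rewrite !inE => /orP[] /eqP-> /orP[] /eqP-> // /subsetP s; exfalso.
  by have := s i; rewrite !inE !eqs => /(_ isT).
by have := s k; rewrite !inE !eqs => /(_ isT).
Qed.

End ThreeVertices.

(** * Fence sums along a path that ends at [a] *)

Section Paths.

Variables (F : fieldType) (le : rel 'I_3) (I : {pred {mpoly F[3]}}).
Implicit Types (a c : 'X_{1..3}) (ks : seq 'I_3) (x y v : 'I_3).

Lemma count_on_path_nil c G :
  count_on_path I c [::] G = (facets (koszul I c) == G) :> nat.
Proof.
rewrite /count_on_path -sum1_card big_mkcond big_ord_recl big_ord0 inE.
by rewrite path_point0; case: ifP.
Qed.

Lemma count_on_path_cons c x ks G :
  count_on_path I c (x :: ks) G =
    ((facets (koszul I c) == G) + count_on_path I (c - U_(x))%MM ks G)%N.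
Proof.
rewrite /count_on_path -!sum1_card big_mkcond big_ord_recl inE path_point0.
rewrite [in RHS]big_mkcond /=; congr (_ + _)%N.
by apply: eq_bigr => l _; rewrite !inE path_point_cons.
Qed.

Hypothesis I_monomial : monomial_ideal I.

Lemma path_end_sub a ks t :
  t \in koszul I a -> t \in koszul I (a + \sum_(x <- ks) U_(x))%MM.
Proof. by apply: koszul_le => //; apply: lem_addr. Qed.

Lemma path_behead a x ks :
  (a + \sum_(y <- x :: ks) U_(y) - U_(x) = a + \sum_(y <- ks) U_(y))%MM.
Proof. by rewrite big_cons addmA (addmC a) -addmA addmC addmK. Qed.

Lemma path_head_le a x ks : (U_(x) <= a + \sum_(y <- x :: ks) U_(y))%MM.
Proof. by rewrite big_cons addmA (addmC a) -addmA lem_addr. Qed.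

(** The vertex [v] survives in all degrees above [a], in particular in the one reached by the step
    along [x]; coning with [x] gives the edge one step earlier. *)
Lemma edge_before_step a x ks v : x != v -> [set v] \in koszul I a ->
  [set x; v] \in koszul I (a + \sum_(y <- x :: ks) U_(y))%MM.
Proof.
move=> xv va; apply: koszul_cone => //; first exact: path_head_le.
  by rewrite inE.
by rewrite path_behead path_end_sub.
Qed.

Lemma vertex_after_step c x v : (U_(x) <= c)%MM -> x != v ->
  ([set v] \in koszul I (c - U_(x))%MM) = ([set x; v] \in koszul I c).
Proof.
move=> xc xv; apply/idP/idP => [|xvK]; first by apply: koszul_cone; rewrite ?inE.
have : [set x; v] \in faces (koszul I c) 1 by rewrite inE xvK cards2 xv.
move/koszul_link => /(_ x); rewrite !inE eqxx => /(_ isT).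
by rewrite setD1_edge // => /andP[].
Qed.

Hypotheses (le_anti : antisymmetric le) (le_total : total le).

(** The shrubbery at [x] contributes [[v = y] - [v = x]], and over all vertices [x] of [K^a] the
    second term sums to 1. *)
Lemma fence_sum_nil a v y : [set v] \in koszul I a ->
  fence_sum le I a [::] [set v] [set y] =
    #|[set x | [set x] \in koszul I a]|%:R * (v == y)%:R - 1 :> F.
Proof.
move=> va; rewrite /= sum_shrubberies_vertex; last by exists v.
under eq_bigr do rewrite circuit_vertex !ffunE !(inj_eq set1_inj).
rewrite sumrB sumr_const cardsE mulr_natl; congr (_ - _).
by rewrite (bigD1 v) //= eqxx big1 ?addr0 // => x /andP[_]; rewrite eq_sym => /negPf->.
Qed.

Lemma hedge_count_nil a v : [set v] \in koszul I a ->
  hedge_count le I a [::] = #|[set x | [set x] \in koszul I a]|%:R :> F.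
Proof.
move=> va; rewrite /= sum_shrubberies_vertex; last by exists v.
by rewrite sumr_const cardsE.
Qed.

(** A step along the centre [i] gives [2 u j - u k] at [j], a step along the leaf [j] gives
    [- 2 u i]. *)
Lemma cherry_step i j k c v u : uniq [:: i; j; k] ->
    [set j; k] \notin koszul I c -> [set i; j] \in koszul I c ->
    [set i; k] \in koszul I c ->
  step_sum le (koszul I c) v u [set j] =
    ((v == i)%:R * u [set j] - (v == j)%:R * u [set i]) *+ 2 +
    ((v == k)%:R * u [set i] - (v == i)%:R * u [set k]) :> F.
Proof.
move=> ijk jkK ijK ikK; have K_closed := @koszul_sub _ _ _ I_monomial c.
have K1 := faces1_cherry ijk jkK ijK ikK.
have K0 := faces0_cherry ijk K_closed ijK ikK.
have [ij ik jk] := uniq3P ijk.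
have ji : j != i by rewrite eq_sym.
have jiF : [set j; i] \in faces (koszul I c) 1 by rewrite setUC K1 !inE eqxx.
have ikF : [set i; k] \in faces (koszul I c) 1 by rewrite K1 !inE eqxx orbT.
by rewrite (step_sum_cherry le_anti le_total ijk K1 K0) !push_arc.
Qed.

Lemma cherry_count i j k c : uniq [:: i; j; k] ->
    [set j; k] \notin koszul I c -> [set i; j] \in koszul I c ->
    [set i; k] \in koszul I c ->
  \sum_(ST | hedge F le (koszul I c) 1 ST) 1 = 3%:R :> F.
Proof.
move=> ijk jkK ijK ikK; have K_closed := @koszul_sub _ _ _ I_monomial c.
have K1 := faces1_cherry ijk jkK ijK ikK.
have K0 := faces0_cherry ijk K_closed ijK ikK.
rewrite (sum_hedges_cherry F le_anti le_total ijk K1 K0); ring.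
Qed.

Lemma edge_step i j k c v u : uniq [:: i; j; k] ->
    [set j; k] \notin koszul I c -> [set i; j] \in koszul I c ->
    [set i; k] \notin koszul I c ->
  [/\ step_sum le (koszul I c) v u [set i] =
        (v == j)%:R * u [set i] - (v == i)%:R * u [set j] :> F,
      step_sum le (koszul I c) v u [set j] =
        (v == i)%:R * u [set j] - (v == j)%:R * u [set i] :> F &
      step_sum le (koszul I c) v u [set k] = 0 :> F].
Proof.
move=> ijk jkK ijK ikK; have K_closed := @koszul_sub _ _ _ I_monomial c.
have K1 := faces1_single ijk jkK ijK ikK.
have iK : [set i] \in koszul I c by apply: K_closed ijK _; rewrite sub1set !inE eqxx.
have jK : [set j] \in koszul I c.
  by apply: K_closed ijK _; rewrite sub1set !inE eqxx orbT.
have [ij ik jk] := uniq3P ijk.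
have ji : j != i by rewrite eq_sym.
have K1' : faces (koszul I c) 1 = [set [set j; i]] by rewrite setUC.
split.
- by rewrite (step_sum_single le_anti le_total ij K1 iK jK) push_arc // K1 inE.
- by rewrite (step_sum_single le_anti le_total ji K1' jK iK) push_arc // K1' inE.
rewrite (step_sum_single_isolated le_anti le_total ij K1 iK jK) //;
by rewrite (inj_eq set1_inj) eq_sym.
Qed.

Lemma edge_count i j k c : uniq [:: i; j; k] ->
    [set j; k] \notin koszul I c -> [set i; j] \in koszul I c ->
    [set i; k] \notin koszul I c ->
  \sum_(ST | hedge F le (koszul I c) 1 ST) 1 = 2%:R :> F.
Proof.
move=> ijk jkK ijK ikK; have K_closed := @koszul_sub _ _ _ I_monomial c.
have K1 := faces1_single ijk jkK ijK ikK.
have iK : [set i] \in koszul I c by apply: K_closed ijK _; rewrite sub1set !inE eqxx.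
have jK : [set j] \in koszul I c.
  by apply: K_closed ijK _; rewrite sub1set !inE eqxx orbT.
have [ij ik jk] := uniq3P ijk.
by rewrite (sum_hedges_single F le_anti le_total ij K1 iK jK).
Qed.

Hypothesis two_neq0 : 2%:R != 0 :> F.

Lemma fence_sum_cons c x ks sigma s : fence_sum le I c (x :: ks) sigma s =
  step_sum le (koszul I c) x (fence_sum le I (c - U_(x))%MM ks sigma) s :> F.
Proof. by []. Qed.

Lemma hedge_count_cons c x ks : hedge_count le I c (x :: ks) =
  (\sum_(ST | hedge F le (koszul I c) 1 ST) 1) *
  hedge_count le I (c - U_(x))%MM ks :> F.
Proof. by []. Qed.

(** If both leaves survive to [a], all steps are along [i] and every degree before [a] is a cherry.
    The formulas are the iterates of [(p, q) -> (2 p - q, 2 q - p)], whose eigenvalues are 1 and 3.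
    As [K^a] itself is no cherry, the count of cherries is the number of steps. *)
Lemma fence_sum_leaves i j k a ks : uniq [:: i; j; k] ->
    [set j] \in koszul I a -> [set k] \in koszul I a ->
    facets (koszul I a) != [set [set i; j]; [set i; k]] ->
    let c := (a + \sum_(x <- ks) U_(x))%MM in
    [set j; k] \notin koszul I c ->
  [/\ all (pred1 i) ks, count_on_path I c ks [set [set i; j]; [set i; k]] = size ks,
      hedge_count le I c ks = 3%:R ^+ size ks * hedge_count le I a [::] :> F &
  forall sigma (u := fence_sum le I a [::] sigma), 
    fence_sum le I c ks sigma [set j] =
      ((3%:R ^+ size ks + 1) * u [set j] -
       (3%:R ^+ size ks - 1) * u [set k]) / 2%:R :> F /\
    fence_sum le I c ks sigma [set k] =
      ((3%:R ^+ size ks + 1) * u [set k] -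
       (3%:R ^+ size ks - 1) * u [set j]) / 2%:R :> F].
Proof.
move=> ijk ja ka nf; elim: ks => [|x ks IH].
  move=> c; rewrite /c big_nil addm0 expr0 => _; split=> //.
  - by rewrite count_on_path_nil (negPf nf).
  - by rewrite mul1r.
  move=> sigma.
  move: (fence_sum _ _ _ _ _ [set j]) (fence_sum _ _ _ _ _ [set k]) => p q.
  by split; field.
move=> c' jkK; have [ij ik jk] := uniq3P ijk.
set c := (a + _)%MM in c' jkK *.
rewrite {}/c' in jkK *.
(* A step along [j] or [k] would make [jk] a face of [K^c]. *)
have xi : x = i.
  have := mem_uniq3 x ijk; rewrite !inE => /or3P[/eqP // | | ] /eqP xE.
    by case/negP: jkK; rewrite -xE; apply: edge_before_step; rewrite // xE.
  by case/negP: jkK; rewrite setUC -xE; apply: edge_before_step; rewrite // xE eq_sym.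
have ijK : [set i; j] \in koszul I c.
  by rewrite -xi; apply: edge_before_step; rewrite // xi.
have ikK : [set i; k] \in koszul I c.
  by rewrite -xi; apply: edge_before_step; rewrite // xi.
have K_closed := @koszul_sub _ _ _ I_monomial c.
have jkK' : [set j; k] \notin koszul I (a + \sum_(y <- ks) U_(y))%MM.
  apply: contra jkK; apply: koszul_le => //.
  by rewrite -(path_behead a x ks) lem_subr.
(* The recursion at [k] is the one at [j] with the two leaves exchanged. *)
have ikj : uniq [:: i; k; j] by rewrite /= !inE negb_or ik ij eq_sym jk.
have := IH jkK'; rewrite -(path_behead a x ks) -/c => -[alli cnt hc fs]; split.
- by rewrite /= xi eqxx.
- by rewrite count_on_path_cons cnt (facets_cherry ijk K_closed jkK ijK ikK) eqxx.
- by rewrite hedge_count_cons (cherry_count ijk) // hc exprS mulrA.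
move=> sigma; have [fj fk] := fs sigma.
rewrite !fence_sum_cons (cherry_step _ _ ijk) //.
rewrite (cherry_step _ _ ikj) //; last by rewrite setUC.
rewrite xi eqxx (negPf ij) (negPf ik) -xi fj fk -[size (x :: ks)]/(size ks).+1 exprS.
by rewrite mulr1n !mulr0n; split; field.
Qed.

(** Now [i] and [j] survive to [a] and [k] does not. Complexes shrink along the path, so cherries
    come first and single edges after them. The powers of 2 come from the single edges and from the
    final shrubbery. The last conclusion serves the steps that lose [k], after which no cherry
    follows. *)
Lemma fence_sum_edge i j k a ks sigma (w : F) : uniq [:: i; j; k] ->
    [set i] \in koszul I a -> [set j] \in koszul I a ->
    [set k] \notin koszul I a -> [set i; j] \notin koszul I a ->
    hedge_count le I a [::] = 2%:R :> F ->
    fence_sum le I a [::] sigma [set j] = w ->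
    fence_sum le I a [::] sigma [set i] = - w ->
    let c := (a + \sum_(x <- ks) U_(x))%MM in
    [set j; k] \notin koszul I c ->
  let r := count_on_path I c ks [set [set i; j]; [set i; k]] in
  let m := count_on_path I c ks [set [set i; j]; [set k]] in
  let s := count_on_path I c ks [set [set i; j]] in
  [/\ hedge_count le I c ks = 3%:R ^+ r * 2%:R ^+ (m + s).+1 :> F,
      fence_sum le I c ks sigma [set j] = (3%:R ^+ r + 1) / 2%:R * w,
      [set k] \in koszul I c ->
        fence_sum le I c ks sigma [set k] = - ((3%:R ^+ r - 1) / 2%:R * w) &
      [set k] \notin koszul I c ->
        r = 0%N /\ fence_sum le I c ks sigma [set i] = - w].
Proof.
move=> ijk ia ja ka ija hca fj fi.
have [ij ik jk] := uniq3P ijk.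
have edges_neq : [/\ ([set i; j] == [set i; k]) = false,
    ([set i; j] == [set k]) = false & ([set i; k] == [set k]) = false].
  split; apply/negP=> /eqP/setP.
  - by move/(_ j); rewrite !inE eqxx orbT eq_sym (negPf ij) (negPf jk).
  - by move/(_ i); rewrite !inE eqxx (negPf ik).
  - by move/(_ i); rewrite !inE eqxx (negPf ik).
have [eq1 eq2 eq3] := edges_neq.
elim: ks => [|x ks IH] c; rewrite {}/c.
  rewrite big_nil addm0 => _.
  (* Nothing is counted at [a]: each facet set in question contains [ij], which is not a face of
     [K^a]. *)
  have nf (G : {set {set 'I_3}}) : [set i; j] \in G -> count_on_path I a [::] G = 0%N.
    move=> ijG; rewrite count_on_path_nil; apply/eqP; rewrite eqb0.
    by apply: contra ija => /eqP fG; rewrite -fG in ijG; apply: facets_sub ijG.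
  rewrite !nf ?set11 ?setU11 // fj expr0 hca; split=> [|||_].
  - by rewrite addn0 expr1 mul1r.
  - by field.
  - by move=> ka'; case/negP: ka.
  - by rewrite fi.
set c := (a + _)%MM => jkK.
have K_closed := @koszul_sub _ _ _ I_monomial c.
have cE := path_behead a x ks; rewrite -/c in cE.
have xc : (U_(x) <= c)%MM by apply: path_head_le.
have jkK' : [set j; k] \notin koszul I (c - U_(x))%MM.
  by apply: contra jkK; apply: koszul_le => //; apply: lem_subr.
(* A step along [k] would come from the edge [jk], because [j] survives. *)
have xij : x = i \/ x = j.
  have := mem_uniq3 x ijk; rewrite !inE => /or3P[/eqP | /eqP | /eqP xE]; auto.
  by case/negP: jkK; rewrite setUC -xE; apply: edge_before_step; rewrite // xE eq_sym.
have ijK : [set i; j] \in koszul I c.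
  case: xij => xE; first by rewrite -xE; apply: edge_before_step; rewrite // xE.
  by rewrite setUC -xE; apply: edge_before_step; rewrite // xE eq_sym.
move: IH; rewrite -cE => /(_ jkK').
set r := count_on_path _ _ _ [set _; [set i; k]]; set m := count_on_path _ _ _ _.
set s := count_on_path _ _ _ _ => -[hc uj uk ui].
rewrite !count_on_path_cons -/r -/m -/s hedge_count_cons hc !fence_sum_cons.
clearbody r m s.
have ikj : uniq [:: i; k; j] by rewrite /= !inE negb_or ik ij eq_sym jk.
have k_after y : x = y -> y != k ->
    ([set k] \in koszul I (c - U_(x))%MM) = ([set y; k] \in koszul I c).
  by move=> xy yk; rewrite vertex_after_step // xy.
have [ikK | ikK] := boolP ([set i; k] \in koszul I c).
  have kK : [set k] \in koszul I c.
    by apply: K_closed ikK _; rewrite sub1set !inE eqxx orbT.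
  rewrite (facets_cherry ijk K_closed jkK ijK ikK) eqxx.
  have -> : ([set [set i; j]; [set i; k]] == [set [set i; j]; [set k]]) = false.
    by apply/negP=> /eqP/setP/(_ [set k]); rewrite !inE eqxx !(eq_sym [set k]) eq2 eq3.
  have -> : ([set [set i; j]; [set i; k]] == [set [set i; j]]) = false.
    by apply/negP=> /eqP/setP/(_ [set i; k]); rewrite !inE eqxx eq_sym eq1.
  have [ji ki kj] : [/\ (j == i) = false, (k == i) = false & (k == j) = false].
    by rewrite !(eq_sym j) !(eq_sym k) (negPf ij) (negPf ik) (negPf jk).
  rewrite (cherry_count ijk) // (cherry_step _ _ ijk) //.
  rewrite (cherry_step _ _ ikj) //; last by rewrite setUC.
  rewrite !add0n add1n kK !exprS.
  (* A step along [i] keeps [k] because [ik] is a face; a step along [j] loses it because [jk] is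
     not. In the second case this is the last cherry. *)
  have [[xE u1 u2] | [xE [r0 u1]]] : [/\ x = i,
        fence_sum le I (c - U_(x))%MM ks sigma [set j] = (3%:R ^+ r + 1) / 2%:R * w &
        fence_sum le I (c - U_(x))%MM ks sigma [set k] = - ((3%:R ^+ r - 1) / 2%:R * w)]
      \/ x = j /\ r = 0%N /\ fence_sum le I (c - U_(x))%MM ks sigma [set i] = - w.
    case: xij => xE; [left | right]; split=> //.
      by apply: uk; rewrite (k_after i).
    by apply: ui; rewrite (k_after j).
  - have [-> -> ->] : [/\ (x == i) = true, (x == j) = false & (x == k) = false].
      by rewrite xE eqxx (negPf ij) (negPf ik).
    rewrite u1 u2 mulr1n !mulr0n; split=> [|||//]; first by rewrite !mulrA.
      by move: (fence_sum _ _ _ _ _ [set i]) (3%:R ^+ r) => f q; field.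
    by move: (fence_sum _ _ _ _ _ [set i]) (3%:R ^+ r) => f q _; field.
  have [-> -> ->] : [/\ (x == i) = false, (x == j) = true & (x == k) = false].
    by rewrite xE eqxx ji (negPf jk).
  rewrite u1 r0 expr0 mulr1n !mulr0n; split=> [|||//]; first by rewrite !mulrA.
    by move: (fence_sum _ _ _ _ _ [set j]) (fence_sum _ _ _ _ _ [set k]) => f g; field.
  by move: (fence_sum _ _ _ _ _ [set j]) (fence_sum _ _ _ _ _ [set k]) => f g _; field.
have [fK1 fK2 fK3] : [/\ (facets (koszul I c) == [set [set i; j]; [set i; k]]) = false,
    (facets (koszul I c) == [set [set i; j]; [set k]]) = ([set k] \in koszul I c) &
    (facets (koszul I c) == [set [set i; j]]) = ([set k] \notin koszul I c)].
  have [kK | kK] := boolP ([set k] \in koszul I c).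
    rewrite (facets_edge_vertex ijk K_closed jkK ijK ikK kK) eqxx; split=> //.
      by apply/negP=> /eqP/setP/(_ [set i; k]); rewrite !inE eqxx orbT eq_sym eq1 eq3.
    by apply/negP=> /eqP/setP/(_ [set k]); rewrite !inE eqxx orbT eq_sym eq2.
  rewrite (facets_edge ijk K_closed ijK kK) eqxx; split=> //.
    by apply/negP=> /eqP/setP/(_ [set i; k]); rewrite !inE eqxx orbT eq_sym eq1.
  by apply/negP=> /eqP/setP/(_ [set k]); rewrite !inE eqxx orbT eq_sym eq2.
(* Neither [ik] nor [jk] is a face, so both possible steps remove [k]. *)
have k_lost : [set k] \notin koszul I (c - U_(x))%MM.
  by case: xij => xE; [rewrite (k_after i) | rewrite (k_after j)].
have [r0 ui'] := ui k_lost; have := edge_step x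
  (fence_sum le I (c - U_(x))%MM ks sigma) ijk jkK ijK ikK.
rewrite fK1 fK2 fK3 (edge_count ijk) // uj ui' r0 add0n expr0 => -[-> -> ->].
have xi1 : x = i -> ((x == i)%:R = 1 :> F) * ((x == j)%:R = 0 :> F).
  by move=> ->; rewrite eqxx (negPf ij).
have xj1 : x = j -> ((x == i)%:R = 0 :> F) * ((x == j)%:R = 1 :> F).
  by move=> ->; rewrite eqxx eq_sym (negPf ij).
split.
- by case: ([set k] \in _); rewrite ?(add0n, add1n, addSn, addnS) !exprS ?expr0; ring.
- by case: xij => xE; [rewrite !xi1 // | rewrite !xj1 //]; field.
- by move=> _; rewrite subrr; ring.
move=> _; split=> //.
by case: xij => xE; [rewrite !xi1 // | rewrite !xj1 //]; field.
Qed.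

End Paths.

(** * Lattice paths and the assembly of the entries *)

Lemma sum_unit_multinoms (s : seq 'I_3) x :
  (\sum_(y <- s) U_(y))%MM x = count_mem x s.
Proof.
elim: s => [|y s IH]; first by rewrite big_nil mnm0E.
by rewrite big_cons mnmDE mnm1E IH.
Qed.

(** The number of steps in each direction is a coordinate of [b - a]. If only [x] occurs in one
    path, no other path exists, and a sylvan entry is a single contribution. *)
Lemma lattice_paths_straight (a b : 'X_{1..3}) x
    (lam : (mdeg b - mdeg a).-tuple 'I_3) :
  lam \in lattice_paths a b -> all (pred1 x) lam -> lattice_paths a b = [set lam].
Proof.
move=> lamP allx; apply/setP=> lam'; rewrite [RHS]inE; apply/idP/eqP => [|-> //].
move: lamP; rewrite !inE => /eqP lamE /eqP lam'E.
have all' : all (pred1 x) lam'.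
  apply/allP=> y ylam'; apply/negPn/negP=> /= yx.
  have: (a + \sum_(z <- lam) U_(z))%MM y = (a + \sum_(z <- lam') U_(z))%MM y.
    by rewrite -lamE -lam'E.
  rewrite !mnmDE !sum_unit_multinoms => /addnI /eqP; rewrite eq_sym.
  rewrite (all_pred1P _ _ allx) count_nseq /= (eq_sym x) (negPf yx) mul0n -leqn0 leqNgt.
  by rewrite -has_count has_pred1 ylam'.
apply: val_inj; rewrite /= (all_pred1P _ _ allx) (all_pred1P _ _ all').
by rewrite !size_tuple.
Qed.

Lemma first_step (a b : 'X_{1..3}) i (lam : (mdeg b - mdeg a).-tuple 'I_3) :
    lam \in lattice_paths a b -> b = (path_point b lam 1 + U_(i))%MM ->
  exists ks, tval lam = i :: ks /\ b = (a + \sum_(x <- i :: ks) U_(x))%MM.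
Proof.
rewrite inE => /eqP bE; case lamE: (tval lam) bE => [|x ks] bE /mnmP/(_ i).
  (* On an empty path the point in position 1 is [b] again, which would give [b = b + e_i]. *)
  rewrite /path_point /= big_nil subm0 mnmDE mnm1E eqxx => /eqP.
  by rewrite -{1}[b i]addn0 eqn_add2l.
(* So [b - e_x] is not truncated, and comparing coordinates at [i] yields [x = i]. *)
have xb : (U_(x) <= b)%MM by rewrite bE path_head_le.
rewrite path_point_cons path_point0 -{1}(submK xb) !mnmDE !mnm1E eqxx => /addnI.
by case: eqVneq bE => // -> bE _; exists ks.
Qed.

Lemma exists_in_set1 (T : finType) (A : T) (P : pred T) :
  [exists u in [set A], P u] = P A.
Proof.
by apply/exists_inP/idP => [[u /set1P->] | PA] //; exists A; rewrite ?set11.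
Qed.

Lemma exists_in_setU (T : finType) (A B : {set T}) (P : pred T) :
  [exists u in A :|: B, P u] = [exists u in A, P u] || [exists u in B, P u].
Proof.
apply/exists_inP/orP => [[u /setUP[uA | uB] Pu] | [] /exists_inP[u uA Pu]].
- by left; apply/exists_inP; exists u.
- by right; apply/exists_inP; exists u.
- by exists u; rewrite // inE uA.
by exists u; rewrite // inE uA orbT.
Qed.

Lemma mem_facet_vertex (F : fieldType) (I : {pred {mpoly F[3]}}) c v :
    monomial_ideal I ->
  ([set v] \in koszul I c) = [exists u in facets (koszul I c), v \in u].
Proof.
move=> I_monomial; apply/idP/exists_inP => [/sub_facet[u uK] | [u /facets_sub uK vu]].
  by rewrite sub1set => vu; exists u.
by apply: koszul_sub uK _ => //; rewrite sub1set.
Qed.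

Lemma path_contribution_edge (F : fieldType) (le : rel 'I_3)
    (I : {pred {mpoly F[3]}}) b i y ks sigma :
    faces (koszul I b) (1 + 1) = set0 -> i != y -> [set i; y] \in koszul I b ->
  path_contribution le I 1 b (i :: ks) sigma [set i; y] =
    (hedge_count le I (b - U_(i))%MM ks)^-1 *
    (face_sign F le i [set i; y] * fence_sum le I (b - U_(i))%MM ks sigma [set y]).
Proof.
move=> Kb iy iyK; have iyF : [set i; y] \in faces (koszul I b) 1.
  by rewrite inE iyK cards2 iy.
rewrite path_contributionE // !inE eqxx mul1r setD1_edge // bdry_edge //.
rewrite ffunE !scale_chainE !face_chainE !(inj_eq set1_inj) eqxx eq_sym (negPf iy).
by rewrite mulr1 mulr0 addr0.
Qed.

Theorem theorem4p1 (F : fieldType)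
    (char2 : 2%N \notin [pchar F]) (char3 : 3%N \notin [pchar F])
    (le : rel 'I_3) (le_refl : reflexive le) (le_anti : antisymmetric le)
    (le_trans : transitive le) (le_total : total le)
    (I : {pred {mpoly F[3]}}) (I_monomial : monomial_ideal I)
    (i j k : 'I_3) (ijk_distinct : uniq [:: i; j; k])
    (a b : 'X_{1..3}) (le_ab : (a <= b)%MM)
    (Kb_hollow :
      facets (koszul I b) = [set [set i; j]; [set i; k]; [set j; k]])
    (Ka_disconnected : betti F le (koszul I a) 0 <> 0%N)
    (lam : (mdeg b - mdeg a).-tuple 'I_3) (lam_path : lam \in lattice_paths a b)
    (lam_first : b = (path_point b lam 1 + U_(i))%MM)
    (r s m : nat)
    (r_def : r = count_on_path I b lam [set [set i; j]; [set i; k]])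
    (s_def : s = count_on_path I b lam [set [set i; j]])
    (m_def : m = count_on_path I b lam [set [set i; j]; [set k]])
    (sg : 'I_3 -> F)
    (sg_i : sg i = face_sign F le j [set i; j])
    (sg_j : sg j = face_sign F le i [set i; j])
    (sg_k : sg k = face_sign F le j [set i; j]) :
  let Ka := koszul I a in
  let Dlam v tau := path_contribution le I 1 b lam [set v] tau in
  let D v tau := sylvan_entry le I 1 a b [set v] tau in
  [/\ forall v, [set v] \in Ka -> Dlam v [set j; k] = 0,
      facets Ka = [set [set j]; [set k]] ->
        forall v, [set v] \in Ka -> D v [set i; j] = 1 / 2%:R * sg v,
      facets Ka = [set [set i; j]; [set k]] \/
      facets Ka = [set [set i]; [set j]; [set k]] ->
        [/\ D i [set i; j] = sg i * (1 / 3%:R ^+ r.+1),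
            D j [set i; j] =
              sg j * ((3%:R ^+ r.+1 + 1) / (2%:R * 3%:R ^+ r.+1)) &
            D k [set i; j] =
              sg k * ((3%:R ^+ r.+1 - 1) / (2%:R * 3%:R ^+ r.+1))] /\
        [/\ D i [set i; k] =
              face_sign F le k [set i; k] * (1 / 3%:R ^+ r.+1),
            D k [set i; k] = face_sign F le i [set i; k] *
              ((3%:R ^+ r.+1 + 1) / (2%:R * 3%:R ^+ r.+1)) &
            D j [set i; k] = face_sign F le k [set i; k] *
              ((3%:R ^+ r.+1 - 1) / (2%:R * 3%:R ^+ r.+1))]
    & facets Ka = [set [set i]; [set j]] ->
        [/\ forall v, [set v] \in Ka ->
              Dlam v [set i; j] =
                sg v * ((3%:R ^+ r + 1) / (3%:R ^+ r * 2%:R ^+ (m + s + 2))),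
            Dlam i [set i; k] = face_sign F le i [set i; k] *
              ((3%:R ^+ r - 1) / (3%:R ^+ r * 2%:R ^+ (m + s + 2))) &
            Dlam j [set i; k] = face_sign F le k [set i; k] *
              ((3%:R ^+ r - 1) / (3%:R ^+ r * 2%:R ^+ (m + s + 2)))]].
Proof.
move=> Ka Dlam D.
have two_neq0 : 2%:R != 0 :> F by move: char2; rewrite inE.
have three_neq0 : 3%:R != 0 :> F by move: char3; rewrite inE.
have [ij ik jk] := uniq3P ijk_distinct.
have [ji ki kj] : [/\ (j == i) = false, (k == i) = false & (k == j) = false].
  by rewrite !(eq_sym j) !(eq_sym k) (negPf ij) (negPf ik) (negPf jk).
have [ks [lamE bE]] := first_step lam_path lam_first.
set c := (a + \sum_(x <- ks) U_(x))%MM.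
have cE : (b - U_(i))%MM = c by rewrite bE path_behead.
have ib : (U_(i) <= b)%MM by rewrite bE path_head_le.
have Kb_closed := @koszul_sub _ _ _ I_monomial b.
have [ijK ikK jkK] : [/\ [set i; j] \in facets (koszul I b),
    [set i; k] \in facets (koszul I b) & [set j; k] \in facets (koszul I b)].
  by rewrite Kb_hollow; split; rewrite !inE eqxx ?orbT.
(* Coning [jk] with [i] would fill the triangle, although [jk] is a facet of [K^b]. *)
have jk_c : [set j; k] \notin koszul I c.
  apply/negP; rewrite -cE => jkc.
  have : i |: [set j; k] \in koszul I b.
    by apply: koszul_cone; rewrite // !inE negb_or ij ik.
  move/(facets_max jkK)/(_ (subsetUr _ _)) => e.
  have := setU11 i [set j; k]; rewrite e.
  by rewrite !inE (negPf ij) (negPf ik).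
have Kb2 : faces (koszul I b) (1 + 1) = set0.
  apply/setP=> t; rewrite in_set0; apply/negP; rewrite inE => /andP[tK /eqP[t3]].
  have tT : t = setT.
    by apply/eqP; rewrite eqEcard subsetT cardsT card_ord t3.
  have := in_setT k; rewrite -tT (facets_max ijK tK) ?tT ?subsetT //.
  by rewrite !inE ki kj.
have k_c : [set k] \in koszul I c by rewrite -cE vertex_after_step // facets_sub.
(* The degree [b] is never counted, as [jk] is a facet there, so the counts may start at [c]. *)
have not_Kb (G : {set {set 'I_3}}) : [set j; k] \notin G ->
    count_on_path I b lam G = count_on_path I c ks G.
  move=> jkG; rewrite lamE count_on_path_cons cE.
  suff -> : (facets (koszul I b) == G) = false by [].
  by apply/negP=> /eqP bG; rewrite -bG jkK in jkG.
have [ij_jk ik_jk] :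
    ([set j; k] == [set i; j]) = false /\ ([set j; k] == [set i; k]) = false.
  by split; apply/negP=> /eqP/setP/(_ i); rewrite !inE eqxx (negPf ij) (negPf ik).
have k_jk : ([set j; k] == [set k]) = false.
  by apply/negP=> /eqP/setP/(_ j); rewrite !inE eqxx (negPf jk).
have rE : r = count_on_path I c ks [set [set i; j]; [set i; k]].
  by rewrite r_def not_Kb // !inE ij_jk ik_jk.
have sE : s = count_on_path I c ks [set [set i; j]].
  by rewrite s_def not_Kb // !inE ij_jk.
have mE : m = count_on_path I c ks [set [set i; j]; [set k]].
  by rewrite m_def not_Kb // !inE ij_jk k_jk.
have signs : [/\ sg i = - sg j, sg k = - sg j &
    face_sign F le k [set i; k] = - face_sign F le i [set i; k]].
  by rewrite sg_i sg_j sg_k !(face_signC _ le_anti le_total).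
have [sgi sgk sgik] := signs.
have Dlam_ij v : Dlam v [set i; j] =
    (hedge_count le I c ks)^-1 * (sg j * fence_sum le I c ks [set v] [set j]).
  rewrite /Dlam lamE.
  by rewrite (path_contribution_edge le ks [set v] Kb2 ij (facets_sub ijK)) cE sg_j.
have Dlam_ik v : Dlam v [set i; k] = (hedge_count le I c ks)^-1 *
    (face_sign F le i [set i; k] * fence_sum le I c ks [set v] [set k]).
  rewrite /Dlam lamE.
  by rewrite (path_contribution_edge le ks [set v] Kb2 ik (facets_sub ikK)) cE.
(* This is also the number of possible final shrubberies. *)
pose nV := #|[set x | [set x] \in Ka]|.
have setN (A B : {set 'I_3}) x : x \in A -> x \notin B -> (A == B) = false.
  by move=> xA; apply: contraNF => /eqP <-.
have q_neq0 : 3%:R ^+ r != 0 :> F by rewrite expf_neq0.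
(* When [j] and [k] both survive, the path is straight along [i]: it is the only path, and [r] is
   the length of [ks]. *)
have straight : [set j] \in Ka -> [set k] \in Ka ->
    facets Ka != [set [set i; j]; [set i; k]] ->
    [/\ hedge_count le I c ks = 3%:R ^+ r * nV%:R :> F,
      forall v tau, D v tau = Dlam v tau &
      forall v, [set v] \in Ka ->
        fence_sum le I c ks [set v] [set j] =
          ((3%:R ^+ r + 1) * (nV%:R * (v == j)%:R - 1) -
           (3%:R ^+ r - 1) * (nV%:R * (v == k)%:R - 1)) / 2%:R :> F /\
        fence_sum le I c ks [set v] [set k] =
          ((3%:R ^+ r + 1) * (nV%:R * (v == k)%:R - 1) -
           (3%:R ^+ r - 1) * (nV%:R * (v == j)%:R - 1)) / 2%:R :> F].
  move=> ja ka nf.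
  have [alli cnt hc fs] := fence_sum_leaves I_monomial le_anti le_total two_neq0
    ijk_distinct ja ka nf jk_c.
  rewrite hc rE cnt (hedge_count_nil le ja); split=> // [v tau | v va].
    have alllam : all (pred1 i) lam by rewrite lamE /= eqxx.
    by rewrite /D /sylvan_entry (lattice_paths_straight lam_path alllam) big_set1.
  by have [-> ->] := fs [set v]; rewrite !fence_sum_nil.
split.
(* A fence from [jk] would have to drop [i] first, which is not in [jk]. *)
- move=> v _; rewrite /Dlam lamE (path_contributionE _ _ _ _ Kb2); last first.
    by rewrite inE facets_sub // cards2 jk.
  by rewrite !inE (negPf ij) (negPf ik) !mul0r mulr0.
- move=> fE.
  have memV v : ([set v] \in Ka) = (v == j) || (v == k).
    by rewrite mem_facet_vertex // fE exists_in_setU !exists_in_set1 !inE.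
  have VE : nV = 2%N.
    have -> : nV = #|[set j; k]| by apply: eq_card => v; rewrite in_set memV !inE.
    by rewrite cards2 jk.
  have ja : [set j] \in Ka by rewrite memV eqxx.
  have ka : [set k] \in Ka by rewrite memV eqxx orbT.
  have nf : facets Ka != [set [set i; j]; [set i; k]].
    rewrite fE; apply/negP=> /eqP/setP/(_ [set i; k]).
    by rewrite !inE eqxx orbT !(@setN _ _ i) // !inE ?eqxx ?(negPf ij) ?(negPf ik).
  have [hc DE fs] := straight ja ka nf.
  (* The fence sum is [3^r] at [v = j] and [- 3^r] at [v = k]; against the [2 * 3^r] hedgerows only
     one half remains. *)
  move=> v va; rewrite DE Dlam_ij hc (fs v va).1 VE.
  move: va; rewrite memV => /orP[] /eqP->; rewrite eqxx.
    by rewrite (negPf jk) mulr1n mulr0n; field; rewrite two_neq0 q_neq0.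
  by rewrite kj sgk mulr1n mulr0n; field; rewrite two_neq0 q_neq0.
- move=> fE.
  have V_all v : [set v] \in Ka.
    rewrite mem_facet_vertex //; have := mem_uniq3 v ijk_distinct.
    by case: fE => ->; rewrite !exists_in_setU !exists_in_set1 !inE // orbA.
  have VE : nV = 3%N.
    by rewrite -(card_ord 3); apply: eq_card => v; rewrite in_set V_all.
  have nf : facets Ka != [set [set i; j]; [set i; k]].
    have [ik_ij ik_i ik_j ik_k] : [/\ ([set i; k] == [set i; j]) = false,
        ([set i; k] == [set i]) = false, ([set i; k] == [set j]) = false &
        ([set i; k] == [set k]) = false].
      split; [apply: (@setN _ _ k) | apply: (@setN _ _ k) | apply: (@setN _ _ i) |
        apply: (@setN _ _ i)];
      by rewrite !inE ?eqxx ?orbT ?(negPf ij) ?(negPf ik) ?ki ?kj.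
    by case: fE => ->; apply/negP=> /eqP/setP/(_ [set i; k]);
      rewrite !inE eqxx orbT ik_k ?ik_ij ?ik_i ?ik_j.
  have [hc DE fs] := straight (V_all j) (V_all k) nf.
  (* The three final shrubberies turn [3^r] into [3^(r+1)]. From [ij], the fence sums at [i], [j],
     [k] are -1 and plus or minus the halves of [3^(r+1) + 1] and [3^(r+1) - 1]. *)
  rewrite !DE !Dlam_ij !Dlam_ik hc !(fs _ (V_all _)).1 !(fs _ (V_all _)).2 VE.
  rewrite sgi sgk sgik !eqxx (negPf ij) (negPf ik) (negPf jk) kj exprS mulr1n !mulr0n.
  by split; split; field; rewrite two_neq0 three_neq0 q_neq0.
move=> fE.
have memV v : ([set v] \in Ka) = (v == i) || (v == j).
  by rewrite mem_facet_vertex // fE exists_in_setU !exists_in_set1 !inE.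
have VE : nV = 2%N.
  have -> : nV = #|[set i; j]| by apply: eq_card => v; rewrite in_set memV !inE.
  by rewrite cards2 ij.
have ia : [set i] \in Ka by rewrite memV eqxx.
have ja : [set j] \in Ka by rewrite memV eqxx orbT.
have ka : [set k] \notin Ka by rewrite memV ki kj.
have ija : [set i; j] \notin Ka.
  apply/negP=> /sub_facet[u]; rewrite fE !inE => /orP[] /eqP-> /subsetP uE.
    by have := uE j; rewrite !inE eqxx orbT ji => /(_ isT).
  by have := uE i; rewrite !inE eqxx (negPf ij) => /(_ isT).
have hca : hedge_count le I a [::] = 2%:R :> F.
  by rewrite (hedge_count_nil le ia : _ = nV%:R) VE.
have pow_neq0 : 2%:R ^+ (m + s) != 0 :> F by rewrite expf_neq0.
(* The value [w] of [fence_sum_edge] is 1 for [v = j] and -1 for [v = i]. *)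
have edge v : [set v] \in Ka ->
    [/\ hedge_count le I c ks = 3%:R ^+ r * 2%:R ^+ (m + s).+1 :> F,
      fence_sum le I c ks [set v] [set j] =
        (3%:R ^+ r + 1) / 2%:R * (2%:R * (v == j)%:R - 1) :> F &
      fence_sum le I c ks [set v] [set k] =
        - ((3%:R ^+ r - 1) / 2%:R * (2%:R * (v == j)%:R - 1)) :> F].
  move=> va.
  have fj : _ = nV%:R * _ - 1 := fence_sum_nil le j va.
  have fi : _ = nV%:R * _ - 1 := fence_sum_nil le i va.
  rewrite VE in fj fi.
  have fi' : fence_sum le I a [::] [set v] [set i] = - (2%:R * (v == j)%:R - 1) :> F.
    rewrite fi; move: va; rewrite memV => /orP[] /eqP->; rewrite eqxx.
      by rewrite (negPf ij) mulr1n mulr0n; ring.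
    by rewrite ji mulr1n mulr0n; ring.
  have := fence_sum_edge I_monomial le_anti le_total two_neq0 ijk_distinct
    ia ja ka ija hca fj fi' jk_c.
  by rewrite -rE -mE -sE => -[? ? uk _]; split=> //; apply: uk.
split=> [v va||].
(* In the exponent [m + s + 2], all but one of the factors 2 come from the hedgerows and the last
   from the half in the fence sum. *)
- have [hc uj _] := edge v va; rewrite Dlam_ij hc uj addn2 !exprS.
  move: va; rewrite memV => /orP[] /eqP->.
    by rewrite (negPf ij) sgi mulr0n; field; rewrite two_neq0 q_neq0 pow_neq0.
  by rewrite eqxx mulr1n; field; rewrite two_neq0 q_neq0 pow_neq0.
- have [hc _ uk] := edge i ia; rewrite Dlam_ik hc uk addn2 !exprS (negPf ij) mulr0n.
  by field; rewrite two_neq0 q_neq0 pow_neq0.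
have [hc _ uk] := edge j ja; rewrite Dlam_ik hc uk addn2 !exprS eqxx sgik mulr1n.
by field; rewrite two_neq0 q_neq0 pow_neq0.
Qed.
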